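(* Let $\phi_0\in\mathfrak L_m(\mathbb K)$ and let $\mathcal A\subset\mathcal I$ be an admissible set at $\phi_0$. Then: 1. Every deformation $h:\mathcal O_{\phi_0}\to A$ of $\phi_0$, with $A$ a Noetherian complete local $\mathbb K$-algebra with residue field $\mathbb K$, is equivalent to a deformation $h_0$ of the form $$h_0:\ \mathcal O_{\phi_0}\xrightarrow{\ \pi\ }\mathcal O^{\mathcal A}_{\phi_0}\xrightarrow{\ \overline h_0\ }A,$$ where $\pi$ is the quotient map and $\overline h_0$ is a local $\mathbb K$-morphism. 2. The canonical deformation $\mathrm{id}:\mathcal O^{\mathcal A}_{\phi_0}\to\mathcal O^{\mathcal A}_{\phi_0}$ of $\phi_0$ in the slice $\mathfrak L^{\mathcal A}_{m,\phi_0}$, i.e. the law $\phi_0+Y$ given by the germs of the coordinate functions, can be written over the completion $\widehat{\mathcal O^{\mathcal A}_{\phi_0}}$ as $$\phi_0+Y=\phi_0+y+g(y),\qquad \Omega(y)=0,$$ where $y=(Y_\alpha)_{\alpha\in\mathcal H^2}$ is the component of $Y$ in $\mathfrak m\otimes\mathrm H^2$, for a Hodge decomposition at $\phi_0$ compatible with $\mathcal A$ and the associated maps $g$ and $\Omega$.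
   Context: $\mathbb K$ is an algebraically closed field of characteristic $0$. $\mathfrak L_m$ is the affine scheme of Lie algebra laws on $\mathbb K^m$; $\mathcal O_{\phi_0}$ is its local ring at $\phi_0$. Local rings are local $\mathbb K$-algebras with residue field $\mathbb K$ and maximal ideal $\mathfrak m$. A deformation of $\phi_0$ with base $A$ is a local $\mathbb K$-morphism $\mathcal O_{\phi_0}\to A$, equivalently an element of $\mathrm{Def}(\phi_0,A)=\{\phi\in\mathfrak L_m(A):\phi\equiv\phi_0 \bmod \mathfrak m\}$; two are equivalent if in the same orbit of $\mathrm G_m(A)=\mathrm{id}+\mathrm M_m(\mathfrak m)$ acting by $s*\phi=s\circ\phi\circ(s^{-1}\times s^{-1})$. Let $\mathfrak g=(\mathbb K^m,\phi_0)$, $\mathrm C^k=\mathrm C^k(\mathfrak g,\mathfrak g)=\mathrm{Hom}(\wedge^k\mathfrak g,\mathfrak g)$ with Chevalley–Eilenberg differential $d$ (adjoint coefficients), cocycles $\mathrm Z^k$, coboundaries $\mathrm B^k$, and the Nijenhuis–Richardson bracket $[\cdot,\cdot]$, normalized by $df=(-1)^{k+1}[\phi_0,f]$ for $f\in\mathrm C^k$ and so that $\phi$ is a Lie law iff $[\phi,\phi]=0$; all extended $A$-linearly. Fix a basis $(e_\alpha)_{\alpha\in\mathcal I}$ of $\mathrm C^2$, $\phi=\sum\phi^\alpha e_\alpha$. $\mathcal A\subset\mathcal I$ is admissible at $\phi_0$ if it is minimal such that the forms $L\mapsto(dL)^\alpha$, $\alpha\in\mathcal A$, on $\mathrm C^1$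 have rank $\dim\mathrm B^2$; equivalently $\mathrm V^2_{\mathcal A}:=\langle e_\alpha:\alpha\in\mathcal I\setminus\mathcal A\rangle$ is a complement of $\mathrm B^2$ in $\mathrm C^2$. The slice $\mathfrak L^{\mathcal A}_{m,\phi_0}\subset\mathfrak L_m$ is the closed subscheme $\phi^\alpha=(\phi_0)^\alpha$ ($\alpha\in\mathcal A$), and $\mathcal O^{\mathcal A}_{\phi_0}$ is its local ring at $\phi_0$, a quotient of $\mathcal O_{\phi_0}$. Hodge decomposition: choices of complements $\mathrm C^k=\mathrm B^k\oplus\mathrm H^k\oplus\mathrm W^k$ with $\mathrm Z^k=\mathrm B^k\oplus\mathrm H^k$; it is compatible with $\mathcal A$ if $\mathrm V^2_{\mathcal A}=\mathrm H^2\oplus\mathrm W^2$. $\mathcal H^2$ indexes a basis of $\mathrm H^2$. Subscripts $\mathrm B^3,\mathrm H^3$ denote projections for the decomposition of $\mathrm C^3$. For complete Noetherian local $A$, $g:\mathfrak m\otimes\mathrm Z^2\to\mathfrak m\otimes\mathrm W^2$ is the unique map with $g(0)=0$ such that $\{\xi\in\mathfrak m\otimes\mathrm C^2: d\xi-\tfrac12[\xi,\xi]_{\mathrm B^3}=0\}=\{z+g(z):z\in\mathfrak m\otimes\mathrm Z^2\}$, and $\Omega(z)=[z+g(z),z+g(z)]_{\mathrm H^3}\in\mathfrak m\otimes\mathrm H^3$. In part 2 these are taken with $A=\widehat{\mathcal O^{\mathcal A}_{\phi_0}}$ and restricted to $\mathfrak m\otimes\mathrm H^2$. *)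

(* Defs.v *)
From HB Require Import structures.
From mathcomp Require Import all_boot all_order all_algebra.
From mathcomp.multinomials Require Import mpoly.

Set Implicit Arguments.
Unset Strict Implicit.
Unset Printing Implicit Defensive.

Import GRing.Theory.
Local Open Scope ring_scope.

Definition ksubset (m k : nat) : predArgType := {S : {set 'I_m} | #|S| == k}.
HB.instance Definition _ m k := SubFinite.on (ksubset m k).

(* Hom(wedge^k R^m, R^m), by the values on the basis e_S = e_a1 /\ .. /\ e_ak *)
(* of wedge^k R^m, S = {a1 < .. < ak}.  With R = A a K-algebra this is        *)
(* A (x) C^k.  Vectors are columns.                                           *)
Notation cochain R m k := {ffun ksubset m k -> 'cV[R]_m}.

(* Number of pairs of positions i < j in s with r s_i s_j. *)
Fixpoint inversions (T : Type) (r : rel T) (s : seq T) : nat :=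
  if s is x :: s' then (count (r x) s' + inversions r s')%N else 0%N.

Section Cochains.
Variables (R : comNzRingType) (m : nat).

(* f(e_a1, .., e_ak) for an arbitrary sequence of indices s = [:: a1; ..; ak] *)
(* (and 0 if s has not length k).                                             *)
Definition ceval k (f : cochain R m k) (s : seq 'I_m) : 'cV[R]_m :=
  if uniq s then
    (-1) ^+ inversions (fun i j : 'I_m => j < i)%N s
      *: oapp f 0 (insub [set i in s] : option (ksubset m k))
  else 0.

Definition mceval k (f : cochain R m k) (v : seq 'cV[R]_m) : 'cV[R]_m :=
  \sum_(t : (size v).-tuple 'I_m)
    (\prod_(i < size v) (nth 0 v i) (tnth t i) 0) *: ceval f t.

(* The insertion product, evaluated on basis vectors:                         *)
(*   sum over (q, p)-shuffles of                                              *)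
(*     sgn * f(g(x_s(1), .., x_s(q)), x_s(q+1), .., x_s(q+p)).                *)
(* A shuffle is given by the mask b of the positions fed to g; its sign       *)
(* counts the pairs i < j with j fed to g and i not.                          *)
Definition circ p q (f : cochain R m p.+1) (g : cochain R m q) (s : seq 'I_m) :
    'cV[R]_m :=
  \sum_(b : (size s).-tuple bool | count id b == q)
    (-1) ^+ inversions (fun x y => ~~ x && y) b *:
      \sum_(j < m) (ceval g (mask b s)) j 0 *:
        ceval f (j :: mask (map negb b) s).

(* Nijenhuis-Richardson bracket C^{p+1} x C^{q+1} -> C^{p+q+1}. *)
Definition nrbracket p q (f : cochain R m p.+1) (g : cochain R m q.+1) :
    cochain R m (p + q).+1 :=
  [ffun S : ksubset m (p + q).+1 =>
     circ f g (enum (val S))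
      - (-1) ^+ (p * q) *: circ g f (enum (val S))].

(* [xi, xi] for xi in C^2 *)
Definition nrsquare (xi : cochain R m 2) : cochain R m 3 :=
  @nrbracket 1 1 xi xi.

Definition is_lie_law (phi : cochain R m 2) : Prop := nrsquare phi = 0.

(* Chevalley-Eilenberg differential (adjoint coefficients) in degree k+1:     *)
(* df = (-1)^{deg f + 1} [phi, f], that is, with [u, v] = phi(u, v),          *)
(*   df(x_0, .., x_d) = sum_i (-1)^i [x_i, f(.., ^x_i, ..)]                   *)
(*     + sum_(i < j) (-1)^(i+j) f([x_i, x_j], .., ^x_i, .., ^x_j, ..).        *)
Definition dCE (phi : cochain R m 2) k (f : cochain R m k.+1) :
    cochain R m k.+2 :=
  (-1) ^+ k.+2 *: nrbracket phi f.

Lemma ceval_linear k s : linear (fun f : cochain R m k => ceval f s).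
Proof.
move=> a f g; rewrite /ceval; case: ifP => _; last by rewrite scaler0 addr0.
case: insub => [S|] /=; last by rewrite !(scaler0, addr0).
by rewrite !ffunE scalerDr !scalerA [_ * a]mulrC.
Qed.

Lemma circ_linearr p q (f : cochain R m p.+1) s :
  linear (fun g : cochain R m q => circ f g s).
Proof.
move=> a g h /=; rewrite /circ scaler_sumr.
apply: etrans (big_split _ _ _ _ _) => /=; apply: eq_bigr => b _.
rewrite [in RHS]scalerA [in RHS](mulrC a) -scalerA -scalerDr; congr (_ *: _).
rewrite scaler_sumr; apply: etrans (big_split _ _ _ _ _) => /=.
by apply: eq_bigr => j _; rewrite ceval_linear !mxE scalerDl scalerA.
Qed.

Lemma circ_linearl p q (g : cochain R m q) s :
  linear (fun f : cochain R m p.+1 => circ f g s).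
Proof.
move=> a f h /=; rewrite /circ scaler_sumr.
apply: etrans (big_split _ _ _ _ _) => /=; apply: eq_bigr => b _.
rewrite [in RHS]scalerA [in RHS](mulrC a) -scalerA -scalerDr; congr (_ *: _).
rewrite scaler_sumr; apply: etrans (big_split _ _ _ _ _) => /=.
by apply: eq_bigr => j _; rewrite ceval_linear scalerDr !scalerA [a * _]mulrC.
Qed.

Lemma nrbracket_linearr p q (f : cochain R m p.+1) :
  linear (fun g : cochain R m q.+1 => nrbracket f g).
Proof.
move=> a g h; apply/ffunP => S; rewrite !ffunE circ_linearr circ_linearl.
move: (circ f g _) (circ f h _) (circ g f _) (circ h f _) => x y z t.
set c := (-1) ^+ _.
by rewrite !scalerDr !scalerN scalerA (mulrC c) -scalerA opprD addrACA.
Qed.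

Lemma dCE_linear phi k : linear (@dCE phi k).
Proof.
move=> a f g; rewrite /dCE nrbracket_linearr.
move: (nrbracket phi f) (nrbracket phi g) => x y; set c := (-1) ^+ _.
by rewrite scalerDr !scalerA [c * _]mulrC.
Qed.
HB.instance Definition _ phi k :=
  GRing.isLinear.Build R (cochain R m k.+1) (cochain R m k.+2) *:%R
    (@dCE phi k) (@dCE_linear phi k).

End Cochains.

(* s * phi = s o phi o (s^-1 x s^-1) *)
Definition gauge_act (A : comUnitRingType) m (s : 'M[A]_m)
    (phi : cochain A m 2) : cochain A m 2 :=
  [ffun S : ksubset m 2 =>
     s *m mceval phi [seq col a (invmx s) | a <- enum (val S)]].

Section CommutativeAlgebra.

Definition ideal_gen (R : comNzRingType) (P : R -> Prop) (x : R) : Prop :=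
  exists s : seq (R * R),
    (forall u, u \in s -> P u.2) /\ x = \sum_(u <- s) u.1 * u.2.

Definition is_ideal (R : comNzRingType) (I : R -> Prop) : Prop :=
  [/\ I 0, forall x y, I x -> I y -> I (x + y) & forall a x, I x -> I (a * x)].

Definition noetherian (R : comNzRingType) : Prop :=
  forall I : R -> Prop, is_ideal I ->
    exists s : seq R, forall x, I x <-> ideal_gen (fun y => y \in s) x.

Variable K : fieldType.

(* The maximal ideal of a local ring is the set of its non-units. *)
Definition in_max (A : comUnitRingType) (a : A) : Prop :=
  a \isn't a GRing.unit.

Definition in_max_pow (A : comUnitRingType) (k : nat) : A -> Prop :=
  ideal_gen (fun y => exists t : 'I_k -> A,
    (forall i, in_max (t i)) /\ y = \prod_(i < k) t i).

(* A is local and K -> A / m is onto (hence bijective). *)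
Definition local_residue (A : comUnitAlgType K) : Prop :=
  (forall a b : A, in_max a -> in_max b -> in_max (a + b)) /\
  (forall a : A, exists c : K, in_max (a - c%:A)).

Definition adic_complete (A : comUnitRingType) : Prop :=
  (forall a : A, (forall k, in_max_pow k a) -> a = 0) /\
  (forall u : nat -> A, (forall k, in_max_pow k (u k.+1 - u k)) ->
     exists l, forall k, in_max_pow k (l - u k)).

Definition local_morphism (A B : comUnitRingType) (h : A -> B) : Prop :=
  forall a, in_max a -> in_max (h a).

(* c : R -> S is the completion of the local ring R: S is complete and c      *)
(* induces isomorphisms R / m_R^k -> S / m_S^k for all k.                     *)
Definition is_completion (R S : comUnitAlgType K) (c : {lrmorphism R -> S}) :
    Prop :=
  [/\ local_residue S, adic_complete S,
      forall k x, in_max_pow k (c x) <-> in_max_pow k x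
    & forall k y, exists x, in_max_pow k (y - c x)].

Definition peval n (A : comUnitAlgType K) (x : 'I_n -> A) : {mpoly K[n]} -> A :=
  mmap (in_alg A) x.

(* R, with the germs x of the coordinates, is the local ring at the K-point   *)
(* pt of the closed subscheme of affine n-space cut out by the equations eqs: *)
(* p |-> p(x) exhibits R as the localization of K[X_1..X_n]/(eqs) at the      *)
(* maximal ideal of pt.                                                       *)
Definition is_local_ring_at n (eqs : {mpoly K[n]} -> Prop) (pt : 'I_n -> K)
    (R : comUnitAlgType K) (x : 'I_n -> R) : Prop :=
  [/\ forall q, q.@[pt] != 0 -> peval x q \is a GRing.unit,
      forall r, exists p q, q.@[pt] != 0 /\ r * peval x q = peval x p
    & forall p, peval x p = 0 <->
        exists q, q.@[pt] != 0 /\ ideal_gen eqs (q * p)].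

End CommutativeAlgebra.

Section Deformations.
Variables (K : fieldType) (m : nat).

Section Extension.
Variable A : comAlgType K.

(* C^k -> A (x) C^k *)
Definition cext k (f : cochain K m k) : cochain A m k :=
  [ffun S => map_mx (in_alg A) (f S)].

(* A-linear extension of a K-linear map. *)
Definition lext k l (u : 'Hom(cochain K m k, cochain K m l))
    (xi : cochain A m k) : cochain A m l :=
  \sum_(S : ksubset m k) \sum_(i < m)
    xi S i 0 *: cext (u [ffun S' => if S' == S then delta_mx i 0 else 0]).

Definition law_of n (e : n.-tuple (cochain K m 2)) (x : 'I_n -> A) :
    cochain A m 2 :=
  \sum_(a < n) x a *: cext (tnth e a).

End Extension.

(* Deformations h, h' : O -> A in the same orbit of id + M_m(maximal ideal),  *)
(* where x are the germs in O of the coordinates with respect to e.           *)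
Definition deformation_equiv n (e : n.-tuple (cochain K m 2))
    (O A : comUnitAlgType K) (x : 'I_n -> O) (h h' : O -> A) : Prop :=
  exists s : 'M[A]_m,
    (forall i j, in_max ((s - 1%:M) i j)) /\
    law_of e (h' \o x) = gauge_act s (law_of e (h \o x)).

(* xi lies in (maximal ideal of A) (x) U *)
Definition in_max_tensor (A : comUnitAlgType K) k
    (U : {vspace cochain K m k}) (xi : cochain A m k) : Prop :=
  exists a : 'I_(\dim U) -> A,
    (forall i, in_max (a i)) /\
    xi = \sum_(i < \dim U) a i *: cext A (tnth (vbasis U) i).

Section Complex.
Variable phi0 : cochain K m 2.

Definition dlin k : 'Hom(cochain K m k.+1, cochain K m k.+2) :=
  linfun (dCE phi0 (k := k)).
Definition cocycles k : {vspace cochain K m k.+1} := lker (dlin k).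
Definition coboundaries k : {vspace cochain K m k.+2} := limg (dlin k).

Section Slice.
Variables (n : nat) (e : n.-tuple (cochain K m 2)) (Adm : {set 'I_n}).

(* The linear form L |-> (dL)^a on C^1. *)
Definition dcoord_form (a : 'I_n) : 'Hom(cochain K m 1, K^o) :=
  linfun (fun L => coord e a (dlin 0 L) : K^o).

Definition dcoord_rank (D : {set 'I_n}) : nat :=
  \dim <<[seq dcoord_form a | a in D]>>%VS.

Definition admissible : bool :=
  minset (fun D => dcoord_rank D == \dim (coboundaries 0)) Adm.

Definition slice_space : {vspace cochain K m 2} :=
  <<[seq tnth e a | a in ~: Adm]>>%VS.

Definition generic_law : cochain {mpoly K[n]} m 2 :=
  law_of e (fun a : 'I_n => 'X_a).

Definition lie_eqs (p : {mpoly K[n]}) : Prop :=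
  exists S i, p = nrsquare generic_law S i 0.

Definition base_point (a : 'I_n) : K := coord e a phi0.

Definition slice_eqs (p : {mpoly K[n]}) : Prop :=
  lie_eqs p \/ exists2 a, a \in Adm & p = 'X_a - (base_point a)%:MP.
End Slice.

Section Hodge.
(* C^d = B^d + H + W (direct) with Z^d = B^d + H, in degree d = k + 2. *)
Definition hodge_decomposition k (H W : {vspace cochain K m k.+2}) : Prop :=
  [/\ (coboundaries k + H + W = fullv)%VS,
      directv (coboundaries k + H + W)
    & (cocycles k.+1 = coboundaries k + H)%VS].

(* Only the degrees 2 and 3 of a Hodge decomposition are involved. *)
Variables (H2 W2 : {vspace cochain K m 2}) (H3 W3 : {vspace cochain K m 3}).

Definition hodge_compatible n (e : n.-tuple (cochain K m 2))
    (Adm : {set 'I_n}) : Prop :=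
  [/\ hodge_decomposition H2 W2, hodge_decomposition H3 W3
    & slice_space e Adm = (H2 + W2)%VS].

Definition proj_H2 := daddv_pi H2 (coboundaries 0 + W2).
Definition proj_B3 := daddv_pi (coboundaries 1) (H3 + W3).
Definition proj_H3 := daddv_pi H3 (coboundaries 1 + W3).

Variable A : comUnitAlgType K.

(* The equation determines g on m (x) Z^2, as Z^2 and W^2 are complementary;  *)
(* the values of g elsewhere are irrelevant.                                  *)
Definition is_kuranishi_map (g : cochain A m 2 -> cochain A m 2) : Prop :=
  [/\ forall z, in_max_tensor (cocycles 1) z -> in_max_tensor W2 (g z),
      g 0 = 0
    & forall xi, in_max_tensor fullv xi ->
       (dCE (cext A phi0) xi - 2^-1 *: lext proj_B3 (nrsquare xi) = 0 <->
        exists2 z, in_max_tensor (cocycles 1) z & xi = z + g z)].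

Definition kuranishi_obstruction (g : cochain A m 2 -> cochain A m 2)
    (z : cochain A m 2) : cochain A m 3 :=
  lext proj_H3 (nrsquare (z + g z)).

End Hodge.
End Complex.
End Deformations.

(* Main.v *)
From HB Require Import structures.
From Stdlib Require Import IndefiniteDescription.
Require Import Defs.
From mathcomp Require Import all_boot all_order all_algebra ring zify.
From mathcomp.multinomials Require Import mpoly.

Set Implicit Arguments.
Unset Strict Implicit.
Unset Printing Implicit Defensive.

Import GRing.Theory.
Local Open Scope ring_scope.

(** Fixing the [Adm]-coordinates amounts to choosing the complement V of B^2
    spanned by the other basis vectors.  With s = (1 + L)^-1, the condition
    s * phi = phi0 + eta reads dL - eta = -(zeta + higher order terms), where
    zeta = phi - phi0; splitting C^2 = B^2 + V turns it into a fixed point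
    equation xi = zeta + N xi with eta the V-part of xi and dL minus its
    B^2-part.  N raises the m-adic order, so that completeness of A solves the
    equation; the coordinates of s * phi then define a morphism from the local
    ring of the slice.  The map g is the solution of w = u [z + w, z + w] / 2 for
    a partial inverse u of d : W^2 -> B^3, by the same contraction principle, and
    uniqueness of its solutions identifies Y with y + g y once the Lie equation
    is rewritten as dY = [Y, Y] / 2. *)

(** The inverse is put on [s] so that [s * phi = phi0 + eta], composed with t = 1 + L, becomes
    phi(tu, tv) = t (phi0 + eta)(u, v). This is polynomial in L and eta; with s = 1 + L a power
    series for s^-1 would intervene. Since B^2 + V is direct, both eta and dL can be read off from
    the single unknown xi = eta - dL, and every term left besides zeta is a product of two small
    factors, whence the gain of order.

    V is a complement of B^2 because admissibility is a rank condition: forms of rank dim B^2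
    separate coboundaries, and minimality makes them independent, so [Adm] is small enough for the
    dimensions to add up.

    Much of the length comes from the encoding. Cochains are stored by their values on increasing
    index sets and the bracket is a sum over shuffles, so identities are first transported to
    multilinear formulas on vectors. The main one is d d = 0: it places B^k inside Z^k, without
    which there is no Hodge decomposition. *)

Section Eval.
Variables (R : comNzRingType) (m : nat).
Local Notation vec := 'cV[R]_m.
Implicit Types (F : seq 'I_m -> vec) (u v w : vec).

Definition dl (i : 'I_m) : vec := delta_mx i 0.

(** The recursive form of [mceval]: linearity in each slot goes by induction, and at a given length
    it unfolds to iterated sums. [F] is an arbitrary function of index sequences so that the
    recursion can absorb one index at a time. *)
Fixpoint mev (vs : seq vec) F : vec :=
  if vs is u :: vs' then \sum_i u i 0 *: mev vs' (fun s => F (i :: s))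
  else F [::].

Lemma sum_dl (V : lmodType R) i (f : 'I_m -> V) : \sum_j dl i j 0 *: f j = f i.
Proof.
rewrite (bigD1 i) //= big1 => [|j /negPf ji]; rewrite mxE ?eqxx ?scale1r ?addr0 //.
by rewrite ji scale0r.
Qed.

Lemma mev_dl s F : mev (map dl s) F = F s.
Proof. by elim: s F => [|i s IH] F //=; rewrite sum_dl IH. Qed.

Lemma mev_mceval k (f : cochain R m k) vs : mceval f vs = mev vs (ceval f).
Proof.
rewrite /mceval; move: (ceval f) => {f}F.
elim: vs F => [|u vs IH] F /=.
  rewrite (big_pred1 [tuple]) ?big_ord0 ?scale1r //.
  by move=> t; apply: esym; apply/eqP; rewrite [t]tuple0.
pose h (p : 'I_m * (size vs).-tuple 'I_m) := [tuple of p.1 :: p.2].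
rewrite (reindex h) /=; last first.
  exists (fun t => (thead t, [tuple of behead t])) => [[i t]|t] _.
    by congr (_, _); apply: val_inj.
  by rewrite /h /= -tuple_eta.
rewrite -(pair_bigA _ (fun i (t : (size vs).-tuple 'I_m) =>
   (\prod_(k < (size vs).+1) nth 0 (u :: vs) k (tnth (h (i, t)) k) 0) *: F (i :: t))) /=.
apply: eq_bigr => i _; rewrite -(IH (fun s => F (i :: s))) scaler_sumr.
apply: eq_bigr => t _; rewrite big_ord_recl /= scalerA; congr (_ * _ *: _).
by apply: eq_bigr => j _; rewrite tnthS.
Qed.

Lemma sum_tuple_cons (V : nmodType) k (P : seq bool -> bool) (f : seq bool -> V) :
  \sum_(b : k.+1.-tuple bool | P b) f b =
    \sum_(b : k.-tuple bool | P (true :: b)) f (true :: b) +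
    \sum_(b : k.-tuple bool | P (false :: b)) f (false :: b).
Proof.
pose h (p : bool * k.-tuple bool) := [tuple of p.1 :: p.2].
rewrite (reindex h) /=; last first.
  exists (fun t => (thead t, [tuple of behead t])) => [[i t]|t] _.
    by congr (_, _); apply: val_inj.
  by rewrite /h /= -tuple_eta.
rewrite big_mkcond /=.
rewrite -(pair_bigA _ (fun i (t : k.-tuple bool) =>
   if P (i :: t) then f (i :: t) else 0)) /= big_bool.
by rewrite -!big_mkcond.
Qed.

(** An explicit list, so that at a given length the shuffle sum of [circ] computes to its finitely
    many signed terms. *)
Fixpoint masks k : seq (seq bool) :=
  if k is k'.+1 then map (cons true) (masks k') ++ map (cons false) (masks k')
  else [:: [::]].

Lemma sum_masks (V : nmodType) k (P : seq bool -> bool) (f : seq bool -> V) :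
  \sum_(b : k.-tuple bool | P b) f b = \sum_(b <- masks k | P b) f b.
Proof.
elim: k P f => [|k IH] P f.
  rewrite big_cons big_nil big_mkcond (big_pred1 [tuple]) ?addr0 // => t.
  by apply: esym; apply/eqP; rewrite [t]tuple0.
rewrite sum_tuple_cons (IH (fun b => P (true :: b)) (fun b => f (true :: b))).
rewrite (IH (fun b => P (false :: b)) (fun b => f (false :: b))).
by rewrite /= big_cat !big_map.
Qed.

End Eval.

(** * Multilinearity and alternation of cochains evaluated on vectors *)

Section MultilinearEvaluation.
Variables (R : comNzRingType) (m : nat).
Local Notation vec := 'cV[R]_m.
Local Notation dl := (@dl R m).
Implicit Types (u v w : vec).

Definition ev1 (f : cochain R m 1) u := mev [:: u] (ceval f).
Definition ev2 (f : cochain R m 2) u v := mev [:: u; v] (ceval f).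
Definition ev3 (f : cochain R m 3) u v w := mev [:: u; v; w] (ceval f).

Lemma mev_linear vs vs' (F : seq 'I_m -> vec) :
  linear (fun u => mev (vs ++ u :: vs') F).
Proof.
elim: vs F => [|w vs IH] F a u v /=.
  rewrite scaler_sumr -big_split; apply: eq_bigr => i _ /=.
  by rewrite !mxE scalerDl scalerA.
rewrite scaler_sumr -big_split; apply: eq_bigr => i _ /=.
by rewrite IH scalerDr !scalerA mulrC.
Qed.

Lemma ev1_linear f : linear (ev1 f).
Proof. exact: (mev_linear [::] [::]). Qed.
Lemma ev2_linearl f v : linear (fun u => ev2 f u v).
Proof. exact: (mev_linear [::] [:: v]). Qed.
Lemma ev2_linearr f u : linear (fun v => ev2 f u v).
Proof. exact: (mev_linear [:: u] [::]). Qed.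
Lemma ev3_linear1 f v w : linear (fun u => ev3 f u v w).
Proof. exact: (mev_linear [::] [:: v; w]). Qed.
Lemma ev3_linear2 f u w : linear (fun v => ev3 f u v w).
Proof. exact: (mev_linear [:: u] [:: w]). Qed.
Lemma ev3_linear3 f u v : linear (fun w => ev3 f u v w).
Proof. exact: (mev_linear [:: u; v] [::]). Qed.

Lemma linear_ext (f g : vec -> vec) :
  linear f -> linear g -> (forall i, f (dl i) = g (dl i)) -> f =1 g.
Proof.
have exp (h : vec -> vec) : linear h -> forall u, h u = \sum_i u i 0 *: h (dl i).
  move=> lh u; pose H : {linear vec -> vec} :=
    HB.pack h (GRing.isLinear.Build R vec vec *:%R h lh).
  rewrite {1}[u](matrix_sum_delta u) exchange_big big_ord1.
  rewrite -[h _]/(H _) linear_sum; apply: eq_bigr => i _.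
  by rewrite linearZ.
by move=> lf lg e u; rewrite !exp //; apply: eq_bigr => i _; rewrite e.
Qed.
End MultilinearEvaluation.

Section Alternation.
Variables (R : comNzRingType) (m : nat).
Local Notation vec := 'cV[R]_m.
Implicit Types (G : seq 'I_m -> vec) (s t : seq 'I_m).

(** Vanishing on repeated indices is a separate clause because it does not follow from the sign
    change where 2 is a zero divisor. Only neighbours are exchanged, which keeps the clause
    checkable by cases. *)
Definition alternating k G : Prop :=
  (forall s, size s = k -> ~~ uniq s -> G s = 0) /\
  (forall s1 x y s2, size (s1 ++ x :: y :: s2) = k ->
     G (s1 ++ x :: y :: s2) = - G (s1 ++ y :: x :: s2)).

(** The sign [b] is produced before [G], so two alternating functions acquire the same one. The
    prefix [p] holds the indices already in place during the induction. *)
Lemma alternating_perm s t : perm_eq s t ->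
  exists b : bool, forall p G k, alternating k G -> size (p ++ s) = k ->
    G (p ++ s) = (-1) ^+ b *: G (p ++ t).
Proof.
elim: s t => [|x s IH] t.
  rewrite perm_sym => /perm_nilP ->.
  by exists false => p G k _ _; rewrite expr0 scale1r.
move=> xst; have xt : x \in t by rewrite -(perm_mem xst) mem_head.
case/splitPr: xt xst => t1 t2 xst.
have st : perm_eq s (t1 ++ t2).
  by rewrite -(perm_cons x) (perm_trans xst) // perm_catC /= perm_cons perm_catC.
have [b Hb] := IH _ st.
(* The head [x] has to pass the entries of [t1], one exchange for each. *)
exists (b (+) odd (size t1)) => p G k aG sz.
rewrite -cat_rcons (Hb _ _ k) // ?cat_rcons //.
have {sz}: size (p ++ x :: t1 ++ t2) = k.
  by rewrite -sz !size_cat /= !size_cat (perm_size st) size_cat.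
move=> sz; rewrite signr_addb -scalerA; congr (_ *: _).
elim: t1 p sz {xst st Hb} => [|y t1 IHt] p sz /=; first by rewrite expr0 scale1r.
rewrite (aG.2 _ _ _ _ sz) -cat_rcons IHt; last first.
  by rewrite -sz !size_cat /= size_rcons !size_cat addSnnS.
by rewrite cat_rcons signrN scaleNr.
Qed.

Lemma sorted_enum_ord (A : {set 'I_m}) :
  pairwise (fun i j : 'I_m => ~~ (j < i)%N) (enum A).
Proof.
rewrite {1}/enum_mem; apply: pairwise_filter.
rewrite -enumT; set r := (fun i j : 'I_m => _).
have -> : pairwise r (enum 'I_m) = pairwise (fun i j => ~~ (j < i)%N) (map val (enum 'I_m)).
  by rewrite pairwise_map; apply: eq_pairwise.
rewrite val_enum_ord; apply: (@sub_pairwise _ ltn).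
  by move=> i j /= ij; rewrite -leqNgt ltnW.
by rewrite -sorted_pairwise ?iota_ltn_sorted //; apply: ltn_trans.
Qed.

Lemma inversions_sorted (T : Type) (r : rel T) (s : seq T) :
  pairwise (fun i j => ~~ r i j) s -> inversions r s = 0%N.
Proof.
elim: s => //= x s IH /andP[h /IH ->]; rewrite addn0.
by elim: s h {IH} => //= y s IH /andP[/negPf -> /IH].
Qed.

Lemma ceval_enum k (f : cochain R m k) (S : ksubset m k) :
  ceval f (enum (val S)) = f S.
Proof.
rewrite /ceval enum_uniq inversions_sorted ?sorted_enum_ord // expr0 scale1r.
have -> : [set i in enum (val S)] = val S by apply/setP => i; rewrite inE mem_enum.
by rewrite valK.
Qed.

(** Exchanging two neighbours affects only the inversion between these two; the counts against all
    other entries are symmetric. *)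
Lemma ceval_alternating k (f : cochain R m k) : alternating k (ceval f).
Proof.
split=> [s _ /negPf ns | s1 x y s2 _]; first by rewrite /ceval ns.
have pE : perm_eq (s1 ++ x :: y :: s2) (s1 ++ y :: x :: s2).
  by rewrite perm_cat2l; apply/permP => a /=; rewrite addnCA.
rewrite /ceval (perm_uniq pE); case: ifP => us; last by rewrite oppr0.
have -> : [set i in s1 ++ x :: y :: s2] = [set i in s1 ++ y :: x :: s2].
  by apply/setP => i; rewrite !inE (perm_mem pE).
rewrite -scaleNr; congr (_ *: _).
have {us} xy : x != y.
  by move: us; rewrite cat_uniq => /and3P[_ _]; rewrite /= inE negb_or eq_sym => /andP[/andP[]].
elim: s1 pE => [|a s1 IH] pE; rewrite /= !exprD.
  have -> : (-1) ^+ (y < x)%N = - (-1) ^+ (x < y)%N :> R.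
    by case: ltngtP xy => [||/val_inj ->]; rewrite ?eqxx ?expr0 ?opprK.
  by ring.
move: pE; rewrite perm_cons => pE.
by rewrite IH // mulrN; move/permP: pE => ->.
Qed.

(** Sorting [s] costs both functions the same sign, by [alternating_perm]. *)
Lemma alternating_ext k G G' :
  alternating k G -> alternating k G' ->
  (forall S : ksubset m k, G (enum (val S)) = G' (enum (val S))) ->
  forall s, size s = k -> G s = G' s.
Proof.
move=> aG aG' E s sz.
have [us|us] := boolP (uniq s); last by rewrite aG.1 // aG'.1.
have sk : #|[set i in s]| == k by rewrite cardsE (card_uniqP us) sz.
have pE : perm_eq s (enum [set i in s]).
  by apply: uniq_perm => // [|i]; rewrite ?enum_uniq // mem_enum inE.
have [b Hb] := alternating_perm pE.
rewrite -[s]cat0s (Hb [::] G k) // (Hb [::] G' k) //= ; congr (_ *: _).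
by have := E (Sub [set i in s] sk); rewrite SubK.
Qed.

Lemma alternating2 (F : 'I_m -> 'I_m -> vec) :
  (forall x, F x x = 0) -> (forall x y, F x y = - F y x) ->
  alternating 2 (fun s => if s is [:: x; y] then F x y else 0).
Proof.
move=> F0 FN; split=> [[|x [|y [|]]] //= _|s1 x y s2].
  by rewrite inE andbT negbK => /eqP ->; apply: F0.
rewrite size_cat /= !addnS => /eq_add_S/eq_add_S/eqP.
by rewrite addn_eq0 !size_eq0 => /andP[/eqP-> /eqP->] /=.
Qed.

Lemma alternating3 (F : 'I_m -> 'I_m -> 'I_m -> vec) :
  (forall x y, F x x y = 0) -> (forall x y, F x y y = 0) ->
  (forall x y z, F x y z = - F y x z) -> (forall x y z, F x y z = - F x z y) ->
  alternating 3 (fun s => if s is [:: x; y; z] then F x y z else 0).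
Proof.
move=> F0 F1 FN FN'; split=> [[|x [|y [|z [|]]]]|s1 x y s2] //=.
  move=> _; rewrite !inE !andbT negb_and !negbK => /orP[/orP[]|] /eqP ->; rewrite ?F0 ?F1 //.
  by rewrite FN F1 oppr0.
by case: s1 s2 => [|a [|b [|c s]]] [|? [|? ?]]; rewrite //= size_cat /= !addnS.
Qed.

End Alternation.

(** * The insertion product and the differential in low degrees *)

Section Circ.
Variables (R : comNzRingType) (m : nat).
Local Notation vec := 'cV[R]_m.
Local Notation dl := (@dl R m).
Implicit Types (u v w : vec).

Lemma circE p q (f : cochain R m p.+1) (g : cochain R m q) s :
  circ f g s = \sum_(b <- [seq b <- masks (size s) | count id b == q])
    (-1) ^+ inversions (fun x y => ~~ x && y) b *:
      mev (ceval g (mask b s) :: map dl (mask (map negb b) s)) (ceval f).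
Proof.
rewrite big_filter -(sum_masks _ (fun b => count id b == q) (fun b =>
  (-1) ^+ inversions (fun x y => ~~ x && y) b *:
      mev (ceval g (mask b s) :: map dl (mask (map negb b) s)) (ceval f))).
apply: eq_bigr => b _; congr (_ *: _) => /=.
by apply: eq_bigr => j _; rewrite mev_dl.
Qed.

Lemma ceval_ev1 (f : cochain R m 1) x : ceval f [:: x] = ev1 f (dl x).
Proof. by rewrite -(mev_dl [:: x]). Qed.
Lemma ceval_ev2 (f : cochain R m 2) x y : ceval f [:: x; y] = ev2 f (dl x) (dl y).
Proof. by rewrite -(mev_dl [:: x; y]). Qed.
Lemma ceval_ev3 (f : cochain R m 3) x y z :
  ceval f [:: x; y; z] = ev3 f (dl x) (dl y) (dl z).
Proof. by rewrite -(mev_dl [:: x; y; z]). Qed.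

Lemma circ21 (f : cochain R m 2) (g : cochain R m 1) x y :
  circ f g [:: x; y] = ev2 f (ev1 g (dl x)) (dl y) - ev2 f (ev1 g (dl y)) (dl x).
Proof.
rewrite circE /= !big_cons big_nil /= !ceval_ev1.
by rewrite expr0 expr1 scale1r scaleN1r addr0.
Qed.

Lemma circ12 (f : cochain R m 1) (g : cochain R m 2) x y :
  circ f g [:: x; y] = ev1 f (ev2 g (dl x) (dl y)).
Proof.
by rewrite circE /= !big_cons big_nil /= !ceval_ev2 expr0 scale1r addr0.
Qed.

Lemma circ22 (f g : cochain R m 2) x y z :
  circ f g [:: x; y; z] = ev2 f (ev2 g (dl x) (dl y)) (dl z)
    - ev2 f (ev2 g (dl x) (dl z)) (dl y) + ev2 f (ev2 g (dl y) (dl z)) (dl x).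
Proof.
rewrite circE /= !big_cons big_nil /= !ceval_ev2 addr0.
by rewrite expr0 expr1 !scale1r scaleN1r sqrrN expr1n scale1r addrA.
Qed.

Lemma circ23 (f : cochain R m 2) (g : cochain R m 3) x y z t :
  circ f g [:: x; y; z; t] =
    ev2 f (ev3 g (dl x) (dl y) (dl z)) (dl t)
    - ev2 f (ev3 g (dl x) (dl y) (dl t)) (dl z)
    + ev2 f (ev3 g (dl x) (dl z) (dl t)) (dl y)
    - ev2 f (ev3 g (dl y) (dl z) (dl t)) (dl x).
Proof.
rewrite circE /= !big_cons big_nil /= !ceval_ev3 addr0.
by rewrite !exprS expr0 !mulr1 !mulN1r !opprK !scale1r !scaleN1r !addrA.
Qed.

Lemma circ32 (f : cochain R m 3) (g : cochain R m 2) x y z t :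
  circ f g [:: x; y; z; t] =
    ev3 f (ev2 g (dl x) (dl y)) (dl z) (dl t)
    - ev3 f (ev2 g (dl x) (dl z)) (dl y) (dl t)
    + ev3 f (ev2 g (dl x) (dl t)) (dl y) (dl z)
    + ev3 f (ev2 g (dl y) (dl z)) (dl x) (dl t)
    - ev3 f (ev2 g (dl y) (dl t)) (dl x) (dl z)
    + ev3 f (ev2 g (dl z) (dl t)) (dl x) (dl y).
Proof.
rewrite circE /= !big_cons big_nil /= !ceval_ev2 addr0.
by rewrite !exprS expr0 !mulr1 !mulN1r !opprK !scale1r !scaleN1r !addrA.
Qed.
End Circ.

Section Brackets.
Variables (R : comNzRingType) (m : nat).
Local Notation vec := 'cV[R]_m.
Local Notation dl := (@dl R m).
Implicit Types (u v w : vec).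

Lemma ev1P (L : cochain R m 1) a u v : ev1 L (a *: u + v) = a *: ev1 L u + ev1 L v.
Proof. exact: ev1_linear. Qed.
Lemma ev2Pl (f : cochain R m 2) a u v w :
  ev2 f (a *: u + v) w = a *: ev2 f u w + ev2 f v w.
Proof. exact: (ev2_linearl f w a u v). Qed.
Lemma ev2Pr (f : cochain R m 2) a u v w :
  ev2 f w (a *: u + v) = a *: ev2 f w u + ev2 f w v.
Proof. exact: (ev2_linearr f w a u v). Qed.
Lemma ev1D L u v : ev1 L (u + v) = ev1 L u + ev1 L v.
Proof. by rewrite -[u]scale1r ev1P !scale1r. Qed.
Lemma ev10 (L : cochain R m 1) : ev1 L 0 = 0.
Proof. by apply: (addrI (ev1 L 0)); rewrite -ev1D !addr0. Qed.
Lemma ev1N L u : ev1 L (- u) = - ev1 L u.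
Proof. by rewrite -[- u]addr0 -scaleN1r ev1P ev10 addr0 scaleN1r. Qed.
Lemma ev2Dl f u v w : ev2 f (u + v) w = ev2 f u w + ev2 f v w.
Proof. by rewrite -[u]scale1r ev2Pl !scale1r. Qed.
Lemma ev2Dr f u v w : ev2 f w (u + v) = ev2 f w u + ev2 f w v.
Proof. by rewrite -[u]scale1r ev2Pr !scale1r. Qed.
Lemma ev20l (f : cochain R m 2) u : ev2 f 0 u = 0.
Proof. by apply: (addrI (ev2 f 0 u)); rewrite -ev2Dl !addr0. Qed.
Lemma ev2Nl f u w : ev2 f (- u) w = - ev2 f u w.
Proof. by rewrite -[- u]addr0 -scaleN1r ev2Pl ev20l addr0 scaleN1r. Qed.
Lemma ev2_ext (G : vec -> vec -> vec) (f : cochain R m 2) :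
  (forall v, linear (G^~ v)) -> (forall u, linear (G u)) ->
  (forall x y, ceval f [:: x; y] = G (dl x) (dl y)) -> forall u v, ev2 f u v = G u v.
Proof.
move=> Gl Gr E u v; move: u; apply: linear_ext => [||x]; [exact: ev2_linearl|exact: Gl|].
by move: v; apply: linear_ext => [||y]; [exact: ev2_linearr|exact: Gr|rewrite -ceval_ev2].
Qed.

Lemma ev3_ext (G : vec -> vec -> vec -> vec) (f : cochain R m 3) :
  (forall v w, linear (fun u => G u v w)) -> (forall u w, linear (fun v => G u v w)) ->
  (forall u v, linear (G u v)) ->
  (forall x y z, ceval f [:: x; y; z] = G (dl x) (dl y) (dl z)) ->
  forall u v w, ev3 f u v w = G u v w.
Proof.
move=> G1 G2 G3 E u v w.
move: u; apply: linear_ext => [||x]; [exact: ev3_linear1|exact: G1|].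
move: v; apply: linear_ext => [||y]; [exact: ev3_linear2|exact: G2|].
move: w; apply: linear_ext => [||z]; [exact: ev3_linear3|exact: G3|].
by rewrite -ceval_ev3.
Qed.

Lemma ev2_dlC (f : cochain R m 2) x y : ev2 f (dl x) (dl y) = - ev2 f (dl y) (dl x).
Proof. by rewrite -!ceval_ev2; apply: ((ceval_alternating f).2 [::] x y [::]). Qed.

Lemma ev2_dlxx (f : cochain R m 2) x : ev2 f (dl x) (dl x) = 0.
Proof.
by rewrite -ceval_ev2; apply: (ceval_alternating f).1 => //=; rewrite inE eqxx.
Qed.

Lemma ev2C (f : cochain R m 2) u v : ev2 f u v = - ev2 f v u.
Proof.
move: v; apply: (ev2_ext (G := fun u v => - ev2 f v u)) => [v|{}u|x y].
- by move=> a w w' /=; rewrite ev2Pr opprD scalerN.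
- by move=> a w w' /=; rewrite ev2Pl opprD scalerN.
- by rewrite ceval_ev2 ev2_dlC.
Qed.

(** The trilinear extension of [circ22] to vectors; for f = g it is the Jacobiator. *)
Definition circ_ev (f g : cochain R m 2) u v w : vec :=
  ev2 f (ev2 g u v) w - ev2 f (ev2 g u w) v + ev2 f (ev2 g v w) u.

Lemma circ_ev_linear1 f g v w : linear (fun u => circ_ev f g u v w).
Proof.
move=> a u u'; rewrite /circ_ev !(ev2Pl, ev2Pr) !scalerDr !scalerN.
by apply/colP => i; rewrite !mxE; ring.
Qed.
Lemma circ_ev_linear2 f g u w : linear (fun v => circ_ev f g u v w).
Proof.
move=> a v v'; rewrite /circ_ev !(ev2Pl, ev2Pr) !scalerDr !scalerN.
by apply/colP => i; rewrite !mxE; ring.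
Qed.
Lemma circ_ev_linear3 f g u v : linear (circ_ev f g u v).
Proof.
move=> a w w'; rewrite /circ_ev !(ev2Pl, ev2Pr) !scalerDr !scalerN.
by apply/colP => i; rewrite !mxE; ring.
Qed.

(** The antisymmetries hold for all vectors. Vanishing on repetitions is checked on unit vectors,
    where it comes from [ceval] being 0 on repeated indices and not from a division by 2. *)
Lemma circ_ev_alternating f g : alternating 3 (fun s =>
  if s is [:: x; y; z] then circ_ev f g (dl x) (dl y) (dl z) else 0).
Proof.
have E a b c : circ_ev f g a b c = - circ_ev f g b a c.
  rewrite /circ_ev (ev2C g a b) ev2Nl.
  by apply/colP => i; rewrite !mxE; ring.
have E' a b c : circ_ev f g a b c = - circ_ev f g a c b.
  rewrite /circ_ev (ev2C g b c) ev2Nl.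
  by apply/colP => i; rewrite !mxE; ring.
apply: alternating3 => // x y.
  by rewrite /circ_ev ev2_dlxx ev20l sub0r addNr.
by rewrite /circ_ev ev2_dlxx ev20l addr0 subrr.
Qed.
End Brackets.

Section Differential.
Variables (R : comNzRingType) (m : nat).
Local Notation vec := 'cV[R]_m.
Local Notation dl := (@dl R m).
Implicit Types (u v w : vec).

Lemma enum2 (S : ksubset m 2) : exists x y, enum (val S) = [:: x; y].
Proof.
have : size (enum (val S)) = 2%N by rewrite -cardE (eqP (valP S)).
by case: (enum _) => [|x [|y []]] // _; exists x, y.
Qed.

Lemma enum3 (S : ksubset m 3) : exists x y z, enum (val S) = [:: x; y; z].
Proof.
have : size (enum (val S)) = 3%N by rewrite -cardE (eqP (valP S)).
by case: (enum _) => [|x [|y [|z []]]] // _; exists x, y, z.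
Qed.

Lemma enum4 (S : ksubset m 4) : exists x y z t, enum (val S) = [:: x; y; z; t].
Proof.
have : size (enum (val S)) = 4%N by rewrite -cardE (eqP (valP S)).
by case: (enum _) => [|x [|y [|z [|t []]]]] // _; exists x, y, z, t.
Qed.

Lemma dCE0_enum (phi : cochain R m 2) (L : cochain R m 1) (S : ksubset m 2) :
  dCE phi L S = circ phi L (enum (val S)) - circ L phi (enum (val S)).
Proof. by rewrite !ffunE muln0 expr0 scale1r sqrrN expr1n scale1r. Qed.

Lemma dCE1_enum (phi f : cochain R m 2) (S : ksubset m 3) :
  dCE phi f S = - (circ phi f (enum (val S)) + circ f phi (enum (val S))).
Proof.
rewrite !ffunE mul1n expr1 scaleN1r opprK.
by rewrite !exprS expr0 !mulN1r !opprK scaleN1r.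
Qed.

Lemma dCE2_enum (phi : cochain R m 2) (g : cochain R m 3) (S : ksubset m 4) :
  dCE phi g S = circ phi g (enum (val S)) - circ g phi (enum (val S)).
Proof.
rewrite !ffunE mul1n.
by rewrite !exprS expr0 !mulN1r !opprK !scale1r.
Qed.

(** The defect of L as a derivation of phi. Both sides are bilinear and alternating, so increasing
    pairs of unit vectors suffice. *)
Lemma ev2_dCE phi (L : cochain R m 1) u v :
  ev2 (dCE phi L) u v =
    ev2 phi (ev1 L u) v - ev2 phi (ev1 L v) u - ev1 L (ev2 phi u v).
Proof.
pose G u v := ev2 phi (ev1 L u) v - ev2 phi (ev1 L v) u - ev1 L (ev2 phi u v).
have lG v' : linear (G^~ v').
  move=> a w w'; rewrite /G !(ev2Pl, ev2Pr, ev1P) !scalerDr !scalerN.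
  by apply/colP => i; rewrite !mxE; ring.
have GC u' v' : G u' v' = - G v' u'.
  by rewrite /G (ev2C phi u' v') ev1N; apply/colP => i; rewrite !mxE; ring.
apply: (ev2_ext (G := G)) => // [w|x y].
  by move=> a w1 w2; rewrite !(GC w) lG scalerN opprD.
pose F x y := G (dl x) (dl y).
apply: (alternating_ext (G' := fun s => if s is [:: x; y] then F x y else 0)
  (ceval_alternating _) _ _ (s := [:: x; y])) => //.
  apply: alternating2 => [z|? ?]; last exact: GC.
  by rewrite /F /G ev2_dlxx ev10 subrr subr0.
move=> S; rewrite ceval_enum dCE0_enum.
by have [a [b ->]] := enum2 S; rewrite circ21 circ12.
Qed.

Lemma ev3_dCE phi (f : cochain R m 2) u v w :
  ev3 (dCE phi f) u v w = - (circ_ev phi f u v w + circ_ev f phi u v w).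
Proof.
pose G u v w := - (circ_ev phi f u v w + circ_ev f phi u v w).
apply: (ev3_ext (G := G)) => [v' w'|u' w'|u' v'|x y z].
- move=> a b c; rewrite /G /= !circ_ev_linear1 !scalerN !scalerDr.
  by apply/colP => i; rewrite !mxE; ring.
- move=> a b c; rewrite /G /= !circ_ev_linear2 !scalerN !scalerDr.
  by apply/colP => i; rewrite !mxE; ring.
- move=> a b c; rewrite /G /= !circ_ev_linear3 !scalerN !scalerDr.
  by apply/colP => i; rewrite !mxE; ring.
pose F x y z := G (dl x) (dl y) (dl z).
apply: (alternating_ext (G' := fun s => if s is [:: x; y; z] then F x y z else 0)
  (ceval_alternating _) _ _ (s := [:: x; y; z])) => //; last first.
  move=> S; rewrite ceval_enum dCE1_enum.
  by have [a [b [c ->]]] := enum3 S; rewrite !circ22.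
have [A1 A2] := circ_ev_alternating phi f.
have [B1 B2] := circ_ev_alternating f phi.
apply: alternating3 => [a b|a b|a b c|a b c]; rewrite /F /G.
- have nu : ~~ uniq [:: a; a; b] by rewrite /= !inE eqxx ?andbF.
  have /= -> := A1 [:: a; a; b] erefl nu; have /= -> := B1 [:: a; a; b] erefl nu.
  by rewrite addr0 oppr0.
- have nu : ~~ uniq [:: a; b; b] by rewrite /= !inE eqxx ?andbF.
  have /= -> := A1 [:: a; b; b] erefl nu; have /= -> := B1 [:: a; b; b] erefl nu.
  by rewrite addr0 oppr0.
- by have /= -> := A2 [::] a b [:: c] erefl; have /= -> := B2 [::] a b [:: c] erefl; rewrite -opprD.
- by have /= -> := A2 [:: a] b c [::] erefl; have /= -> := B2 [:: a] b c [::] erefl; rewrite -opprD.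
Qed.

Section Lie.
Hypothesis two_inj : forall x : R, x *+ 2 = 0 -> x = 0.

Lemma nrsquare_enum (phi : cochain R m 2) (S : ksubset m 3) :
  nrsquare phi S = circ phi phi (enum (val S)) *+ 2.
Proof. by rewrite !ffunE mul1n expr1 scaleN1r opprK. Qed.

(** [phi, phi] is twice the Jacobiator, which is where [two_inj] enters; trilinearity carries the
    identity from unit vectors to all vectors. *)
Lemma lie_jacobi phi : is_lie_law phi -> forall u v w, circ_ev phi phi u v w = 0.
Proof.
move=> lie.
have E0 s : size s = 3 -> (if s is [:: x; y; z] then
    circ_ev phi phi (dl x) (dl y) (dl z) else 0) = 0.
  apply: (alternating_ext (G' := fun=> 0) (circ_ev_alternating phi phi)).
    by split=> // *; rewrite oppr0.
  move=> S; have := congr1 (fun f : cochain R m 3 => f S) lie.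
  rewrite nrsquare_enum ffunE; have [a [b [c ->]]] := enum3 S; rewrite circ22.
  move=> /colP H; apply/colP => i; rewrite [RHS]mxE; apply: two_inj.
  by have := H i; rewrite mulmxnE [RHS]mxE.
move=> u v w.
move: u; apply: linear_ext => [||x]; [exact: circ_ev_linear1| |].
  by move=> a b c /=; rewrite scaler0 addr0.
move: v; apply: linear_ext => [||y]; [exact: circ_ev_linear2| |].
  by move=> a b c /=; rewrite scaler0 addr0.
move: w; apply: linear_ext => [||z]; [exact: circ_ev_linear3| |].
  by move=> a b c /=; rewrite scaler0 addr0.
exact: (E0 [:: x; y; z]).
Qed.

Lemma jacobi_lie (phi : cochain R m 2) :
  (forall u v w, circ_ev phi phi u v w = 0) -> is_lie_law phi.
Proof.
move=> J; apply/ffunP => S; rewrite nrsquare_enum ffunE.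
have [a [b [c ->]]] := enum3 S; rewrite circ22.
by have := J (dl a) (dl b) (dl c); rewrite /circ_ev => ->; rewrite mul0rn.
Qed.

Variable phi : cochain R m 2.
Hypothesis lie : is_lie_law phi.

Let J := lie_jacobi lie.

(** Jacobi in the form that bracketing with w is a derivation, oriented for rewriting. *)
Lemma jacobi_rule u v w :
  ev2 phi (ev2 phi u v) w = ev2 phi (ev2 phi u w) v + ev2 phi u (ev2 phi v w).
Proof.
have := J u v w; rewrite /circ_ev (ev2C phi _ u) => /eqP.
by rewrite subr_eq0 subr_eq => /eqP ->; rewrite addrC.
Qed.

(** Once Jacobi has removed the terms with L under two brackets, L applied to the Jacobiator of x,
    y, z remains. *)
Lemma dCE_dCE0 (L : cochain R m 1) : dCE phi (dCE phi L) = 0.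
Proof.
apply/ffunP => S; rewrite dCE1_enum ffunE.
have [x [y [z ->]]] := enum3 S; rewrite !circ22 !ev2_dCE.
move: (dl x) (dl y) (dl z) => {}x {}y {}z.
rewrite !(ev2Dl, ev2Nl).
rewrite (jacobi_rule (ev1 L x) y z) (jacobi_rule (ev1 L y) x z).
rewrite (jacobi_rule (ev1 L z) x y).
have := congr1 (ev1 L) (J x y z); rewrite ev10 /circ_ev !(ev1D, ev1N).
move=> /colP H; apply/colP => i; have := H i; rewrite !mxE => {}H.
by rewrite -[RHS]H; ring.
Qed.

(** Four kinds of terms occur. Those like f(phi(phi(x, y), z), t) vanish by Jacobi inside f ([fJ]);
    phi(phi(f(x, y), z), t) together with phi(f(x, y), phi(z, t)) by Jacobi outside; f(phi(x, y),
    phi(z, t)) by antisymmetry; and phi(f(phi(x, y), z), t) cancel in pairs. *)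
Lemma dCE_dCE1 (f : cochain R m 2) : dCE phi (dCE phi f) = 0.
Proof.
apply/ffunP => S; rewrite dCE2_enum ffunE.
have [x [y [z [t ->]]]] := enum4 S; rewrite circ23 circ32 !ev3_dCE /circ_ev.
move: (dl x) (dl y) (dl z) (dl t) => {}x {}y {}z {}t.
have fJ u v w r : ev2 f (ev2 phi (ev2 phi u v) w) r =
    ev2 f (ev2 phi (ev2 phi u w) v) r - ev2 f (ev2 phi (ev2 phi v w) u) r.
  by rewrite jacobi_rule ev2Dl (ev2C phi u (ev2 phi v w)) ev2Nl.
rewrite !(ev2Dl, ev2Nl).
rewrite (fJ x y z t) (fJ x y t z) (fJ x z t y) (fJ y z t x).
rewrite (ev2C f (ev2 phi z t) (ev2 phi x y)) (ev2C f (ev2 phi y t) (ev2 phi x z)).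
rewrite (ev2C f (ev2 phi y z) (ev2 phi x t)).
rewrite (jacobi_rule (ev2 f x y) z t) (jacobi_rule (ev2 f x z) y t).
rewrite (jacobi_rule (ev2 f x t) y z) (jacobi_rule (ev2 f y z) x t).
rewrite (jacobi_rule (ev2 f y t) x z) (jacobi_rule (ev2 f z t) x y).
apply/colP => i; rewrite !mxE.
(* Otherwise ring compares the coefficients up to unfolding of ev2. *)
do ?[match goal with |- context [fun_of_matrix (ev2 ?g ?u ?v) ?a ?b] =>
  let c := fresh "c" in set c := (fun_of_matrix (ev2 g u v) a b); clearbody c end].
ring.
Qed.
End Lie.
End Differential.

(** * Extension of scalars and base change of cochains *)

Section ScalarExtension.
Variables (K : fieldType) (A : comAlgType K) (m : nat).

Definition cdelta k (S : ksubset m k) (i : 'I_m) : cochain K m k :=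
  [ffun S' => if S' == S then delta_mx i 0 else 0].

Lemma cext_linear k a (f g : cochain K m k) :
  cext A (a *: f + g) = a%:A *: cext A f + cext A g.
Proof.
by apply/ffunP => S; rewrite !ffunE; apply/colP => i;
   rewrite !mxE /= scalerDl mulr_algl scalerA.
Qed.

Lemma cext0 k : cext A (0 : cochain K m k) = 0.
Proof. by apply/ffunP => S; rewrite !ffunE; apply/colP => i; rewrite !mxE rmorph0. Qed.

Lemma cextD k (f g : cochain K m k) : cext A (f + g) = cext A f + cext A g.
Proof. by rewrite -[f]scale1r cext_linear !scale1r. Qed.

Lemma cextZ k a (f : cochain K m k) : cext A (a *: f) = a%:A *: cext A f.
Proof. by rewrite -[a *: f]addr0 cext_linear cext0 addr0. Qed.

Lemma cextN k (f : cochain K m k) : cext A (- f) = - cext A f.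
Proof. by rewrite -scaleN1r cextZ !scaleN1r. Qed.

Lemma cext_sum k (I : Type) (r : seq I) (P : pred I) (F : I -> cochain K m k) :
  cext A (\sum_(i <- r | P i) F i) = \sum_(i <- r | P i) cext A (F i).
Proof. exact: (big_morph (cext A (k := k)) (@cextD k) (cext0 k)). Qed.

Lemma cdelta_expand (R : comNzRingType) k (f : cochain R m k) : f =
  \sum_(S : ksubset m k) \sum_(i < m)
    f S i 0 *: [ffun S' => if S' == S then delta_mx i 0 else 0].
Proof.
apply/ffunP => T; rewrite sum_ffunE (bigD1 T) //= [X in _ + X]big1 ?addr0; last first.
  move=> S ST; rewrite sum_ffunE big1 // => i _.
  by rewrite !ffunE eq_sym (negPf ST) scaler0.
rewrite sum_ffunE {1}[f T](matrix_sum_delta (f T)); apply: eq_bigr => i _.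
by rewrite big_ord1 !ffunE eqxx.
Qed.

Lemma cext_cdelta k (S : ksubset m k) i :
  cext A (cdelta S i) = [ffun S' => if S' == S then delta_mx i 0 else 0].
Proof.
apply/ffunP => T; rewrite !ffunE; case: eqP => _.
  by rewrite map_delta_mx.
by rewrite map_mx0.
Qed.

(** Elementary cochains are defined over K and span over A, so every A-linear identity between
    extended maps reduces to K. *)
Lemma cext_ext k (U : lmodType A) (F G : {linear cochain A m k -> U}) :
  (forall f, F (cext A f) = G (cext A f)) -> F =1 G.
Proof.
move=> E xi; rewrite (cdelta_expand xi) !linear_sum; apply: eq_bigr => S _.
rewrite !linear_sum; apply: eq_bigr => i _.
by rewrite -cext_cdelta !linearZ E.
Qed.

Lemma lext_linear k l (u : 'Hom(cochain K m k, cochain K m l)) : linear (@lext K m A k l u).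
Proof.
move=> a f g; rewrite /lext scaler_sumr -big_split; apply: eq_bigr => S _.
rewrite scaler_sumr -big_split; apply: eq_bigr => i _ /=.
by rewrite !ffunE !mxE scalerDl scalerA.
Qed.
HB.instance Definition _ k l u := GRing.isLinear.Build A (cochain A m k)
  (cochain A m l) *:%R (@lext K m A k l u) (@lext_linear k l u).

Lemma lext_cext k l (u : 'Hom(cochain K m k, cochain K m l)) f :
  lext u (cext A f) = cext A (u f).
Proof.
rewrite [in RHS](cdelta_expand f) linear_sum cext_sum; apply: eq_bigr => S _.
rewrite linear_sum cext_sum; apply: eq_bigr => i _.
by rewrite linearZ cextZ !ffunE mxE.
Qed.

Lemma lext_comp k l p (u : 'Hom(cochain K m l, cochain K m p))
    (v : 'Hom(cochain K m k, cochain K m l)) (xi : cochain A m k) :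
  lext u (lext v xi) = lext (u \o v)%VF xi.
Proof.
have := @cext_ext k _ ((lext u : {linear _ -> _}) \o (lext v : {linear _ -> _}))
  (lext (u \o v)%VF).
by apply=> f /=; rewrite !lext_cext comp_lfunE.
Qed.

Lemma lext_id k (xi : cochain A m k) : lext \1%VF xi = xi.
Proof.
have := @cext_ext k _ (lext \1%VF) idfun.
by apply=> f /=; rewrite lext_cext id_lfunE.
Qed.

Lemma eq_lext k l (u v : 'Hom(cochain K m k, cochain K m l)) :
  u =1 v -> @lext K m A k l u =1 lext v.
Proof. by move=> E; apply: cext_ext => f /=; rewrite !lext_cext E. Qed.

Lemma lextD k l (u v : 'Hom(cochain K m k, cochain K m l)) (xi : cochain A m k) :
  lext (u + v) xi = lext u xi + lext v xi.
Proof.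
have := @cext_ext k _ (lext (u + v))
  ((lext u : {linear _ -> _}) \+ (lext v : {linear _ -> _})).
by apply=> f /=; rewrite !lext_cext add_lfunE cextD.
Qed.

Lemma lextN k l (u : 'Hom(cochain K m k, cochain K m l)) (xi : cochain A m k) :
  lext (- u) xi = - lext u xi.
Proof.
have := @cext_ext k _ (lext (- u)) (GRing.opp \o (lext u : {linear _ -> _})).
by apply=> f /=; rewrite !lext_cext opp_lfunE cextN.
Qed.

End ScalarExtension.

Section Naturality.
Variables (R S : comNzRingType) (h : {rmorphism R -> S}) (m : nat).

(** Stated for any ring morphism because three are used: [in_alg A], which gives [cext], and the
    evaluations of [generic_law] at the base point and at germs. *)
Definition cmap k (f : cochain R m k) : cochain S m k :=
  [ffun T => map_mx h (f T)].

Lemma ceval_cmap k (f : cochain R m k) s : ceval (cmap f) s = map_mx h (ceval f s).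
Proof.
rewrite /ceval; case: ifP => _; last by rewrite map_mx0.
rewrite map_mxZ rmorphXn rmorphN rmorph1; congr (_ *: _).
by case: insub => [T|] /=; rewrite ?ffunE ?map_mx0.
Qed.

Lemma circ_cmap p q (f : cochain R m p.+1) (g : cochain R m q) s :
  circ (cmap f) (cmap g) s = map_mx h (circ f g s).
Proof.
rewrite raddf_sum; apply: eq_bigr => b _.
rewrite /= map_mxZ rmorphXn rmorphN rmorph1; congr (_ *: _).
rewrite raddf_sum; apply: eq_bigr => j _.
by rewrite /= map_mxZ !ceval_cmap mxE.
Qed.

Lemma nrbracket_cmap p q (f : cochain R m p.+1) (g : cochain R m q.+1) :
  nrbracket (cmap f) (cmap g) = cmap (nrbracket f g).
Proof.
apply/ffunP => T; rewrite !ffunE !circ_cmap raddfB /= map_mxZ.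
by rewrite rmorphXn rmorphN rmorph1.
Qed.
End Naturality.

Section DCE.
Variables (K : fieldType) (A : comAlgType K) (m : nat) (phi0 : cochain K m 2).

Lemma dCE_cext k (f : cochain K m k.+1) :
  dCE (cext A phi0) (cext A f) = cext A (dCE phi0 f).
Proof.
rewrite /dCE -[cext A phi0]/(cmap (in_alg A) phi0) -[cext A f]/(cmap (in_alg A) f).
rewrite nrbracket_cmap cextZ; congr (_ *: _).
by rewrite -[RHS]in_algE rmorphXn rmorphN rmorph1.
Qed.

(** Puts d over A among the maps [lext u], which compose with the projections and partial inverses
    chosen over K. *)
Lemma dCE_lext k (xi : cochain A m k.+1) :
  dCE (cext A phi0) xi = lext (dlin phi0 k) xi.
Proof.
by move: xi; apply: cext_ext => f /=; rewrite lext_cext lfunE /= dCE_cext.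
Qed.
End DCE.

(** * Powers of the maximal ideal and the contraction principle *)

Section IdealGen.
Variables (R : comNzRingType) (P : R -> Prop).

Lemma ideal_gen_ideal : is_ideal (ideal_gen P).
Proof.
split=> [|x y [s [Ps ->]] [t [Pt ->]]|a x [s [Ps ->]]].
- by exists [::]; rewrite big_nil.
- exists (s ++ t); rewrite big_cat; split=> // u.
  by rewrite mem_cat => /orP[/Ps|/Pt].
- exists [seq (a * u.1, u.2) | u <- s]; split=> [u /mapP[v /Ps Pv ->] //|].
  by rewrite big_map mulr_sumr; apply: eq_bigr => u _; rewrite mulrA.
Qed.

Lemma ideal_gen_mem x : P x -> ideal_gen P x.
Proof.
by move=> Px; exists [:: (1, x)]; split=> [u|]; rewrite ?big_seq1 ?mul1r // inE => /eqP ->.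
Qed.

Lemma ideal_gen_min (I : R -> Prop) : is_ideal I -> (forall x, P x -> I x) ->
  forall x, ideal_gen P x -> I x.
Proof.
move=> [I0 ID IM] PI x [s [Ps ->]]; rewrite big_seq.
by elim/big_ind: _ => // u /Ps /PI; apply: IM.
Qed.
End IdealGen.

Section MaxPow.
Variables (K : fieldType) (A : comUnitAlgType K).
Hypothesis loc : local_residue A.
Notation mpow := (@in_max_pow A).

Lemma in_max0 : in_max (0 : A). Proof. by rewrite /in_max unitr0. Qed.
Lemma in_maxD (a b : A) : in_max a -> in_max b -> in_max (a + b).
Proof. exact: loc.1. Qed.
Lemma in_maxM (a b : A) : in_max b -> in_max (a * b).
Proof. by rewrite /in_max unitrM => /negPf ->; rewrite andbF. Qed.
Lemma in_maxN (a : A) : in_max a -> in_max (- a).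
Proof. by rewrite -mulN1r; apply: in_maxM. Qed.
Lemma in_max_ideal : is_ideal (@in_max A).
Proof. by split; [exact: in_max0|exact: in_maxD|exact: in_maxM]. Qed.

Lemma mpow_ideal k : is_ideal (mpow k). Proof. exact: ideal_gen_ideal. Qed.
Lemma mpow_0 k : mpow k 0. Proof. by case: (mpow_ideal k). Qed.
Lemma mpowD k a b : mpow k a -> mpow k b -> mpow k (a + b).
Proof. by case: (mpow_ideal k) => _ h _; apply: h. Qed.
Lemma mpowMl k a b : mpow k b -> mpow k (a * b).
Proof. by case: (mpow_ideal k) => _ _ h; apply: h. Qed.
Lemma mpowN k a : mpow k a -> mpow k (- a).
Proof. by rewrite -mulN1r; apply: mpowMl. Qed.
Lemma mpow1 a : mpow 1 a <-> in_max a.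
Proof.
split=> [|ma]; last first.
  by apply: ideal_gen_mem; exists (fun=> a); rewrite big_ord1.
apply: ideal_gen_min; first exact: in_max_ideal.
by move=> y [t [mt ->]]; rewrite big_ord1.
Qed.

Lemma mpow0 a : mpow 0 a.
Proof.
rewrite -[a]mulr1; apply/mpowMl/ideal_gen_mem; exists (fun=> 0).
by split=> [[]//|]; rewrite big_ord0.
Qed.

Lemma mpowM i j a b : mpow i a -> mpow j b -> mpow (i + j) (a * b).
Proof.
move=> ma; move: b; apply: ideal_gen_min.
  split=> [|x y ? ?|c x ?]; first by rewrite mulr0; apply: mpow_0.
    by rewrite mulrDr; apply: mpowD.
  by rewrite mulrCA; apply: mpowMl.
move=> b [s [ms ->]]; move: a ma; apply: ideal_gen_min.
  split=> [|x y ? ?|c x ?]; first by rewrite mul0r; apply: mpow_0.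
    by rewrite mulrDl; apply: mpowD.
  by rewrite -mulrA; apply: mpowMl.
move=> a [t [mt ->]]; apply: ideal_gen_mem.
exists (fun k => match split k with inl k => t k | inr k => s k end).
split=> [k|]; first by case: split.
rewrite big_split_ord /=; congr (_ * _); apply: eq_bigr => k _.
  by rewrite (unsplitK (inl k)).
by rewrite (unsplitK (inr k)).
Qed.

Lemma mpowS k a : mpow k.+1 a -> mpow k a.
Proof.
apply: ideal_gen_min; first exact: mpow_ideal.
move=> y [t [mt ->]]; rewrite big_ord_recl; apply/mpowMl/ideal_gen_mem.
by exists (fun i => t (lift ord0 i)).
Qed.

Lemma mpow_sum k (I : Type) (r : seq I) (P : pred I) (F : I -> A) :
  (forall i, P i -> mpow k (F i)) -> mpow k (\sum_(i <- r | P i) F i).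
Proof. by move=> h; elim/big_ind: _ => //; [apply: mpow_0|apply: mpowD]. Qed.

Lemma in_max_sum (I : Type) (r : seq I) (P : pred I) (F : I -> A) :
  (forall i, P i -> in_max (F i)) -> in_max (\sum_(i <- r | P i) F i).
Proof. by move=> h; elim/big_ind: _ => //; [apply: in_max0|apply: in_maxD]. Qed.

End MaxPow.

Section Contraction.
Variables (K : fieldType) (A : comUnitAlgType K) (m : nat).
Hypothesis loc : local_residue A.
Notation mpow := (@in_max_pow A).
Notation C2 := (cochain A m 2).

Definition small k (xi : cochain A m k) := forall S i, in_max (xi S i 0).
Definition congr_mod k l (x y : cochain A m k) :=
  forall S i, mpow l (x S i 0 - y S i 0).

(* f behaves like a power series in x of order at least j: it gains j - 1      *)
(* powers of m on differences, which makes the order additive under products.  *)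
Definition order j (f : C2 -> A) : Prop :=
  (forall x, small x -> mpow j (f x)) /\
  (forall k x y, small x -> small y -> congr_mod k.+1 x y -> mpow (k + j) (f x - f y)).

Lemma orderD j f g : order j f -> order j g -> order j (fun x => f x + g x).
Proof.
move=> [f1 f2] [g1 g2]; split=> [x mx|k x y mx my xy]; first by apply: mpowD; auto.
by rewrite opprD addrACA; apply: mpowD; auto.
Qed.

Lemma orderM i j f g : order i f -> order j g -> order (i + j) (fun x => f x * g x).
Proof.
move=> [f1 f2] [g1 g2]; split=> [x mx|k x y mx my xy]; first by apply: mpowM; auto.
have -> : f x * g x - f y * g y = f x * (g x - g y) + (f x - f y) * g y by ring.
apply: mpowD; first by rewrite addnCA; apply: mpowM; auto.
by rewrite addnA; apply: mpowM; auto.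
Qed.

Lemma order_cst a : order 0 (fun=> a).
Proof. by split=> *; [apply: mpow0|rewrite subrr; apply: mpow_0]. Qed.

Lemma order_cst_max a : in_max a -> order 1 (fun=> a).
Proof. by split=> *; [apply/mpow1|rewrite subrr; apply: mpow_0]. Qed.

Lemma order_cst0 j : order j (fun=> 0).
Proof. by split=> *; rewrite ?subrr; apply: mpow_0. Qed.

Lemma orderZ j a f : order j f -> order j (fun x => a * f x).
Proof. by move=> h; rewrite -[j]add0n; apply: orderM => //; apply: order_cst. Qed.

Lemma orderN j f : order j f -> order j (fun x => - f x).
Proof.
move=> [h1 h2]; split=> [x mx|k x y mx my xy]; first by apply: mpowN; auto.
by rewrite -opprD; apply: mpowN; auto.
Qed.

Lemma order_sum j (I : Type) (r : seq I) (P : pred I) (F : I -> C2 -> A) :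
  (forall i, P i -> order j (F i)) -> order j (fun x => \sum_(i <- r | P i) F i x).
Proof.
move=> h; split=> [x mx|k x y mx my xy].
  by apply: mpow_sum => i /h[h1 _]; auto.
by rewrite -sumrB; apply: mpow_sum => i /h[_ h2]; auto.
Qed.

Lemma eq_order j f g : f =1 g -> order j f -> order j g.
Proof. by move=> E [h1 h2]; split=> *; rewrite -!E; auto. Qed.

Definition orderv j (F : C2 -> 'cV[A]_m) := forall i, order j (fun x => F x i 0).
Definition orderc k j (F : C2 -> cochain A m k) :=
  forall S i, order j (fun x => F x S i 0).

Lemma orderv_sum j (I : Type) (r : seq I) (P : pred I) (F : I -> C2 -> 'cV[A]_m) :
  (forall i, P i -> orderv j (F i)) -> orderv j (fun x => \sum_(i <- r | P i) F i x).
Proof.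
move=> h k; apply: (@eq_order _ (fun x => \sum_(i <- r | P i) F i x k 0)).
  by move=> x; rewrite summxE.
by apply: order_sum => i /h.
Qed.

Lemma ordervZ i j f F : order i f -> orderv j F -> orderv (i + j) (fun x => f x *: F x).
Proof.
move=> hf hF k; apply: (@eq_order _ (fun x => f x * F x k 0)) (orderM hf (hF k)).
by move=> x; rewrite mxE.
Qed.

Lemma ordervD j F G : orderv j F -> orderv j G -> orderv j (fun x => F x + G x).
Proof.
move=> hF hG k; apply: (@eq_order _ (fun x => F x k 0 + G x k 0)) (orderD (hF k) (hG k)).
by move=> x; rewrite mxE.
Qed.

Lemma ordervN j F : orderv j F -> orderv j (fun x => - F x).
Proof.
move=> hF k; apply: (@eq_order _ (fun x => - F x k 0)) (orderN (hF k)).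
by move=> x; rewrite mxE.
Qed.

Lemma orderv_cst v : orderv 0 (fun=> v).
Proof. by move=> k; apply: order_cst. Qed.

Lemma orderv0 j : orderv j (fun=> 0).
Proof. by move=> k; apply: eq_order (order_cst0 j) => x; rewrite mxE. Qed.

Lemma orderv_ceval k j (F : C2 -> cochain A m k) s :
  orderc j F -> orderv j (fun x => ceval (F x) s).
Proof.
rewrite /ceval; case: uniq => hF; last exact: orderv0.
rewrite -[j]add0n; apply: ordervZ; first exact: order_cst.
by case: insub => [S|] /=; [exact: hF|exact: orderv0].
Qed.

Lemma orderv_ev2 i j k (F : C2 -> cochain A m 2) u v :
  orderc i F -> orderv j u -> orderv k v ->
  orderv (j + (k + i)) (fun x => ev2 (F x) (u x) (v x)).
Proof.
move=> hF hu hv; apply: orderv_sum => a _; apply: ordervZ; first exact: hu.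
by apply: orderv_sum => b _; apply: ordervZ; [exact: hv|exact: orderv_ceval].
Qed.

Lemma orderv_ev1 i j (F : C2 -> cochain A m 1) u :
  orderc i F -> orderv j u -> orderv (j + i) (fun x => ev1 (F x) (u x)).
Proof.
by move=> hF hu; apply: orderv_sum => a _; apply: ordervZ;
   [exact: hu|exact: orderv_ceval].
Qed.

Lemma orderc_nrsquare i (F : C2 -> cochain A m 2) :
  orderc i F -> orderc (i + i) (fun x => nrsquare (F x)).
Proof.
have C G H : orderc i G -> orderc i H ->
    forall s, orderv (i + i) (fun x => @circ A m 1 2 (G x) (H x) s).
  move=> hG hH s; apply: orderv_sum => b _.
  rewrite -[(i + i)%N]add0n; apply: ordervZ; first exact: order_cst.
  apply: orderv_sum => j _; apply: ordervZ; exact: orderv_ceval.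
move=> hF S k; apply: (@eq_order _ (fun x =>
  (circ (p := 1) (F x) (F x) (enum (val S)) -
   (-1) ^+ (1 * 1) *: circ (p := 1) (F x) (F x) (enum (val S))) k 0)).
  by move=> x; rewrite ffunE.
move: k; apply: ordervD; first exact: C.
by apply: ordervN; rewrite -[(i + i)%N]add0n; apply: ordervZ; [exact: order_cst|exact: C].
Qed.

Lemma ordercD k j (F G : C2 -> cochain A m k) :
  orderc j F -> orderc j G -> orderc j (fun x => F x + G x).
Proof.
move=> hF hG S i; apply: eq_order (orderD (hF S i) (hG S i)) => x.
by rewrite !ffunE mxE.
Qed.

Lemma ordercZ k j a (F : C2 -> cochain A m k) :
  orderc j F -> orderc j (fun x => a *: F x).
Proof.
by move=> hF S i; apply: eq_order (orderZ a (hF S i)) => x; rewrite !ffunE mxE.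
Qed.

Lemma orderc_lext k l j u (F : C2 -> cochain A m k) :
  orderc j F -> orderc j (fun x => lext u (F x) : cochain A m l).
Proof.
move=> hF S i.
have : order j (fun x => \sum_(T : ksubset m k) \sum_(a < m)
    cext A (u (cdelta K T a)) S i 0 * F x T a 0).
  by apply: order_sum => T _; apply: order_sum => a _; apply/orderZ/hF.
apply: eq_order.
  move=> x; rewrite /lext sum_ffunE summxE; apply: eq_bigr => T _.
  by rewrite sum_ffunE summxE; apply: eq_bigr => a _; rewrite !ffunE !mxE mulrC.
Qed.

Lemma orderc_id : orderc 1 (fun x => x).
Proof.
by move=> S i; split=> [x mx|k x y _ _ xy]; [exact/mpow1/mx|rewrite addn1; apply: xy].
Qed.

Lemma orderc_cst k f : orderc 0 (fun=> f : cochain A m k).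
Proof. by move=> S i; apply: order_cst. Qed.

Lemma orderc_small k f : small f -> orderc 1 (fun=> f : cochain A m k).
Proof. by move=> mf S i; apply: order_cst_max. Qed.

Hypothesis complete : adic_complete A.

(** Order 2 improves a congruence modulo m^(k+1) to one modulo m^(k+2). Smallness starts the
    induction at m, and separatedness of A ends it. *)
Lemma contraction_unique c (N : C2 -> C2) : orderc 2 N ->
  forall x y, small x -> small y -> x = c + N x -> y = c + N y -> x = y.
Proof.
move=> hN x y mx my ex ey.
have E k : congr_mod k.+1 x y.
  elim: k => [|k IH] S i; first by apply/mpow1 => //; apply/in_maxD/in_maxN.
  have [_ h] := hN S i; have := h k x y mx my IH; rewrite addn2 => {}h.
  by rewrite ex ey !ffunE !mxE opprD addrACA subrr add0r.
apply/ffunP => S; apply/colP => i; apply/eqP; rewrite -subr_eq0; apply/eqP.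
by apply: complete.1 => -[|k]; [exact: mpow0|exact: E].
Qed.

(** Picard iteration from 0, with limits taken entry by entry. *)
Lemma contraction_exists c (N : C2 -> C2) : small c -> orderc 2 N ->
  exists2 x, small x & x = c + N x.
Proof.
move=> mc hN; pose T x := c + N x; pose u k := iter k T 0.
have mT x : small x -> small (T x).
  move=> mx S i; rewrite !ffunE mxE; apply: in_maxD => //; apply/mpow1 => //.
  by apply: mpowS; apply: (hN S i).1.
have mu k : small (u k).
  by elim: k => [|k IH]; [move=> S i; rewrite ffunE mxE; apply: in_max0|exact: mT].
have T2 k x y : small x -> small y -> congr_mod k.+1 x y -> congr_mod k.+2 (T x) (T y).
  move=> mx my xy S i; have [_ h] := hN S i; have := h k x y mx my xy; rewrite addn2.
  by rewrite !ffunE !mxE opprD addrACA subrr add0r.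
have du k : congr_mod k.+1 (u k.+1) (u k).
  elim: k => [|k IH]; last by apply: T2 (mu k.+1) (mu k) IH.
  by move=> S i; apply/mpow1 => //; apply/in_maxD/in_maxN/mu => //; apply: (mu 1%N).
have lim S i : exists l, forall k, mpow k (l - u k S i 0).
  by apply: complete.2 => k; apply/mpowS/du.
pose l0 S := fin_all_exists (lim S).
have [l Hl] := fin_all_exists l0.
pose x : C2 := [ffun S => \col_i l S i].
have ux k : congr_mod k x (u k).
  by move=> S i; rewrite ffunE mxE; apply: Hl.
have mx : small x.
  move=> S i; apply/mpow1 => //; rewrite -[x S i 0](subrK (u 1%N S i 0)).
  by apply: mpowD; [exact: ux|apply/mpow1 => //; apply: mu].
exists x => //; apply/ffunP => S; apply/colP => i; apply/eqP; rewrite -subr_eq0; apply/eqP.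
apply: complete.1 => -[|k]; first exact: mpow0.
(* [u k.+2] is T applied to [u k.+1]: x is close to it by convergence, and T x by one more use of
   the contraction. *)
rewrite -[x S i 0](subrK (u k.+2 S i 0)) -addrA; apply: mpowD.
  exact: mpowS (ux k.+2 S i).
rewrite -opprB; apply/mpowN/mpowS/(T2 k x (u k.+1)) => //.
Qed.

End Contraction.

(** * Admissible sets and complements of the coboundaries *)

Section VspaceLemmas.
Variables (K : fieldType) (V : vectType K).
Implicit Types U W : {vspace V}.

Lemma directv_dim3 (U W X : {vspace V}) :
  directv (U + W + X) = (\dim (U + W + X) == \dim U + \dim W + \dim X)%N.
Proof. by rewrite directvE /=. Qed.

Lemma directv3_cap (U W X : {vspace V}) : directv (U + W + X) ->
  [/\ (U :&: (W + X) = 0)%VS, (W :&: (U + X) = 0)%VS & ((U + W) :&: X = 0)%VS].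
Proof.
rewrite directv_dim3 => /eqP D.
have leq_dim (S T : {vspace V}) : (\dim (S + T) <= \dim S + \dim T)%N.
  by rewrite -dimv_sum_cap leq_addr.
split; apply/eqP; rewrite -dimv_eq0 -leqn0.
- have := dimv_sum_cap U (W + X); rewrite addvA D.
  by have := leq_dim W X; lia.
- have := dimv_sum_cap W (U + X); rewrite addvA (addvC W) D.
  by have := leq_dim U X; lia.
- have := dimv_sum_cap (U + W) X; rewrite D.
  by have := leq_dim U W; lia.
Qed.

Lemma span_vanishing (U : {vspace V}) (F : seq 'Hom(V, K^o)) :
  (forall f, f \in F -> forall v, v \in U -> f v = 0) ->
  forall f, f \in <<F>>%VS -> forall v, v \in U -> f v = 0.
Proof.
move=> F0 f Ff v Uv; rewrite (@coord_span _ _ _ (in_tuple F) f Ff).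
rewrite sum_lfunE big1 // => i _; rewrite lfunE /= F0 ?scaler0 //.
by apply: mem_nth.
Qed.

Definition evaluations k (w : 'I_k -> V) (f : 'Hom(V, K^o)) : 'rV[K]_k :=
  \row_i f (w i).

Lemma evaluations_linear k (w : 'I_k -> V) : linear (evaluations w).
Proof. by move=> a f g; apply/rowP => i; rewrite !mxE !lfunE /= lfunE. Qed.
HB.instance Definition _ k w := GRing.isLinear.Build K 'Hom(V, K^o) 'rV[K]_k *:%R
  (@evaluations k w) (@evaluations_linear k w).

(* The annihilator of U embeds into the dual of a complement of U. *)
Lemma dim_vanishing (U : {vspace V}) (F : seq 'Hom(V, K^o)) :
  (forall f, f \in F -> forall v, v \in U -> f v = 0) ->
  (\dim <<F>> + \dim U <= \dim {:V})%N.
Proof.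
move=> F0; pose w (i : 'I_(\dim U^C)) := (vbasis U^C)`_i.
pose E := linfun (evaluations w).
have ker0 : (<<F>> :&: lker E = 0)%VS.
  apply/eqP; rewrite -subv0; apply/subvP => f; rewrite memv_cap memv_ker memv0.
  case/andP => Ff; rewrite lfunE /= => /eqP/rowP Ef; apply/eqP/lfunP => v.
  rewrite zero_lfunE; have : v \in (U + U^C)%VS by rewrite addv_complf memvf.
  case/memv_addP => v1 Uv1 [v2 Uv2 ->]; rewrite linearD /= (span_vanishing F0 Ff Uv1) add0r.
  rewrite (coord_vbasis Uv2) linear_sum big1 // => i _; rewrite linearZ /=.
  by have := Ef i; rewrite !mxE => ->; rewrite scaler0.
rewrite -(limg_dim_eq ker0); have := dimvS (subvf (E @: <<F>>)).
rewrite [X in (_ <= X)%N]dimvf dim_matrix [X in (_ <= X)%N](mul1n _).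
rewrite [X in (_ <= X)%N]dimv_compl.
by have := dimvS (subvf U); lia.
Qed.
End VspaceLemmas.

Section Admissible.
Variables (K : fieldType) (m : nat) (phi0 : cochain K m 2).
Variables (n : nat) (e : n.-tuple (cochain K m 2)) (Adm : {set 'I_n}).
Hypotheses (e_basis : basis_of fullv e) (adm : admissible phi0 e Adm).
Local Notation forms := [seq dcoord_form phi0 e a | a in Adm].

Lemma dcoord_formE a L : dcoord_form phi0 e a L = coord e a (dlin phi0 0 L).
Proof.
pose f (L : cochain K m 1) : K^o := coord e a (dlin phi0 0 L).
have lf : linear f by move=> c u v; rewrite /f !linearP.
pose F : {linear cochain K m 1 -> K^o} := HB.pack f (GRing.isLinear.Build K _ _ _ f lf).
exact: (lfunE F L).
Qed.

Lemma dim_forms : \dim <<forms>>%VS = \dim (coboundaries phi0 0).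
Proof. by have /minsetP[/eqP] := adm. Qed.

(** The common kernel of the forms contains ker d and, by their rank, has dimension at most dim C^1
    - dim B^2 = dim ker d. So the two kernels agree. *)
Lemma dcoord_forms_inj L :
  (forall a, a \in Adm -> coord e a (dlin phi0 0 L) = 0) -> dlin phi0 0 L = 0.
Proof.
move=> L0; pose N := (\bigcap_(a in Adm) lker (dcoord_form phi0 e a))%VS.
have Z_N : (lker (dlin phi0 0) <= N)%VS.
  apply/subv_bigcapP => a _; apply/subvP => v; rewrite !memv_ker dcoord_formE.
  by move=> /eqP ->; rewrite linear0.
have dimN : (\dim <<forms>> + \dim N <= \dim {:cochain K m 1})%N.
  apply: dim_vanishing => _ /imageP[a Aa ->] v Nv; apply/eqP; rewrite -memv_ker.
  by apply: subvP Nv; apply: bigcapv_inf Aa _.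
have /eqP NZ : N == lker (dlin phi0 0).
  rewrite eq_sym eqEdim Z_N /=; move: dimN; rewrite dim_forms.
  have := limg_ker_dim (dlin phi0 0) fullv; rewrite capfv => <-.
  by rewrite addnC leq_add2r.
have : L \in N.
  rewrite memvE; apply/subv_bigcapP => a Aa.
  by rewrite -memvE memv_ker dcoord_formE L0.
by rewrite NZ memv_ker => /eqP.
Qed.

(** By minimality the forms are independent: one lying in the span of the others could be dropped
    without lowering the rank. *)
Lemma card_admissible : (#|Adm| <= \dim (coboundaries phi0 0))%N.
Proof.
have free_forms : free forms.
  pose X := in_tuple forms; rewrite -[forms]/(tval X); apply/negPn/negP.
  rewrite freeNE => /existsP[i Xi].
  have iA : (i < size (enum Adm))%N
    by rewrite -(size_map (dcoord_form phi0 e)) ltn_ord.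
  have [a0 _] : exists a : 'I_n, a \in enum Adm.
    by case: (enum Adm) iA => // a s _; exists a; rewrite mem_head.
  pose a := nth a0 (enum Adm) i.
  have Aa : a \in Adm by rewrite -mem_enum mem_nth.
  suff rB : dcoord_rank phi0 e (Adm :\ a) == \dim (coboundaries phi0 0).
    have [_ /(_ _ rB (subsetDl _ _)) E] := minsetP adm.
    by move: Aa; rewrite -E !inE eqxx.
  rewrite -dim_forms; apply/eqP; congr (\dim _); apply/eqP; rewrite eqEsubv.
  apply/andP; split; apply/span_subvP => _ /imageP[b Ab ->].
    by apply/memv_span/image_f; move: Ab; rewrite !inE => /andP[].
  have [->|ba] := eqVneq b a; last by apply/memv_span/image_f; rewrite !inE ba.
  move: Xi; rewrite /X /= (nth_map a0) // -/a => Xi; apply: subvP Xi.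
  apply/span_subvP => f; rewrite -map_drop => /mapP[c Dc ->].
  apply/memv_span/image_f; rewrite !inE -mem_enum (mem_drop Dc) andbT.
  (* [c] stands after position [i] in a duplicate-free list, so it is not [a]. *)
  apply/eqP => ca; have := enum_uniq Adm; rewrite -(cat_take_drop i.+1 (enum Adm)).
  rewrite cat_uniq => /and3P[_ /hasPn h _].
  have /negP[] := h _ Dc; by rewrite ca (take_nth a0) // mem_rcons mem_head.
by rewrite -dim_forms (eqnP free_forms) size_map cardE.
Qed.

Lemma coord_slice v a : v \in slice_space e Adm -> a \in Adm -> coord e a v = 0.
Proof.
move=> Vv Aa; have : (slice_space e Adm <= lker (linfun (coord e a : _ -> K^o)))%VS.
  apply/span_subvP => _ /imageP[b Ab ->]; rewrite memv_ker lfunE /= (tnth_nth 0).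
  rewrite coord_free ?(basis_free e_basis) //.
  by have [E|_] := eqVneq b a; rewrite ?eqxx //; move: Ab; rewrite inE E Aa.
by move=> /subvP/(_ _ Vv); rewrite memv_ker lfunE => /eqP.
Qed.

Lemma admissible_cap : (coboundaries phi0 0 :&: slice_space e Adm = 0)%VS.
Proof.
apply/eqP; rewrite -subv0; apply/subvP => v; rewrite memv_cap memv0 => /andP[].
case/memv_imgP => L _ -> Vv; apply/eqP/dcoord_forms_inj => a.
exact: coord_slice.
Qed.

Lemma dim_slice : \dim (slice_space e Adm) = (n - #|Adm|)%N.
Proof.
have : free [seq tnth e a | a in ~: Adm].
  have := basis_free e_basis; rewrite -[tval e]map_tnth_enum.
  rewrite -(perm_free (perm_map _ (permEl (perm_filterC (mem (~: Adm)) _)))).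
  by rewrite map_cat => /catl_free; rewrite /image_mem enumT.
by move/eqnP => ->; rewrite size_map -cardE [LHS]cardsCs setCK card_ord.
Qed.

(** The slice has dimension n - |Adm|, at least the codimension of B^2, and meets B^2 trivially. *)
Lemma admissible_sum : (coboundaries phi0 0 + slice_space e Adm = fullv)%VS.
Proof.
apply/eqP; rewrite eqEdim subvf /= dimv_disjoint_sum ?admissible_cap //.
rewrite dim_slice (vector.size_basis e_basis); have := card_admissible.
by have := max_card (mem Adm); rewrite card_ord; lia.
Qed.
End Admissible.

(** * Existence of Hodge decompositions *)

Section HodgeExists.
Variables (K : fieldType) (m : nat) (phi0 : cochain K m 2).
Hypothesis d0 : forall k (f : cochain K m k.+1), (k < 2)%N -> dlin phi0 k.+1 (dlin phi0 k f) = 0.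

Lemma coboundaries_sub k : (k < 2)%N -> (coboundaries phi0 k <= cocycles phi0 k.+1)%VS.
Proof.
by move=> k2; apply/subvP => _ /memv_imgP[f _ ->]; rewrite memv_ker d0.
Qed.

Lemma hodge_dim k (H W : {vspace cochain K m k.+2}) :
  (coboundaries phi0 k :&: (H + W) = 0)%VS -> (H :&: W = 0)%VS ->
  directv (coboundaries phi0 k + H + W).
Proof.
move=> BV HW; rewrite directv_dim3 -addvA (dimv_disjoint_sum BV).
by rewrite (dimv_disjoint_sum HW) addnA.
Qed.

(** H is the part of V inside Z, and W a complement of H in V. As B lies in Z by d d = 0, the
    modular law gives Z = B + H. The bound on k marks the degrees where [d0] provides d d = 0. *)
Lemma hodge_exists k (V : {vspace cochain K m k.+2}) : (k < 2)%N ->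
  (coboundaries phi0 k + V = fullv)%VS -> (coboundaries phi0 k :&: V = 0)%VS ->
  exists H W, hodge_decomposition phi0 H W /\ V = (H + W)%VS.
Proof.
move=> k2 BV BV0; pose Z := cocycles phi0 k.+1.
have VE : (V :&: Z + (V :\: Z) = V)%VS by rewrite addvC addv_diff_cap.
exists (V :&: Z)%VS, (V :\: Z)%VS; split; last by rewrite VE.
split; first by rewrite -addvA VE.
  apply: hodge_dim; first by rewrite VE.
  apply/eqP; rewrite -subv0 -(capv_diff V Z) subv_cap capvSr.
  by apply: subv_trans (capvSl _ _) (capvSr _ _).
by rewrite vspace_modl ?coboundaries_sub // BV capfv.
Qed.
End HodgeExists.

(** * Local rings at rational points and their universal property *)

Section Evaluation.
Variables (K : fieldType) (n : nat) (A : comUnitAlgType K) (x : 'I_n -> A).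

HB.instance Definition _ := GRing.RMorphism.copy (peval x) (mmap (in_alg A) x).

Lemma pevalX a : peval x 'X_a = x a.
Proof. by rewrite /peval mmapX mmap1U. Qed.

Lemma pevalC c : peval x c%:MP = c%:A.
Proof. exact: mmapC. Qed.

Lemma pevalZ c p : peval x (c *: p) = c *: peval x p.
Proof. by rewrite /peval mmapZ /= mulr_algl. Qed.

Lemma peval_ideal (eqs : {mpoly K[n]} -> Prop) p :
  (forall q, eqs q -> peval x q = 0) -> ideal_gen eqs p -> peval x p = 0.
Proof.
move=> x0; move: p; apply: ideal_gen_min => //.
split=> [|p q ep eq|p q eq]; first exact: rmorph0.
  by rewrite rmorphD /= ep eq addr0.
by rewrite rmorphM /= eq mulr0.
Qed.

(** Congruence to a constant modulo m is stable under sums and products. This is what makes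
    denominators nonzero at [pt] invertible in A. *)
Lemma peval_congr (pt : 'I_n -> K) p : local_residue A ->
  (forall a, in_max (x a - (pt a)%:A)) -> in_max (peval x p - p.@[pt]%:A).
Proof.
move=> loc xpt; pose rel (a : A) (c : K) := in_max (a - c%:A).
have relD a b c d : rel a c -> rel b d -> rel (a + b) (c + d).
  by rewrite /rel scalerDl opprD addrACA; apply: in_maxD.
have relM a b c d : rel a c -> rel b d -> rel (a * b) (c * d).
  move=> ac bd; rewrite /rel.
  have -> : a * b - (c * d)%:A = a * (b - d%:A) + d%:A * (a - c%:A).
    by rewrite -[(c * d)%:A]scalerA -[c *: d%:A]mulr_algl; move: (c%:A) (d%:A) => c' d'; ring.
  by apply: in_maxD => //; apply: in_maxM.
have relC c : rel c%:A c by rewrite /rel subrr; apply: in_max0.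
have rel1 : rel 1 1 by rewrite /rel scale1r subrr; apply: in_max0.
rewrite -/(rel _ _); elim/mpolyind: p => [|c mon p _ _ IH].
  by rewrite rmorph0 meval0 /rel scale0r subrr; apply: in_max0.
rewrite rmorphD mevalD /= pevalZ -mulr_algl mevalZ /=; apply: relD => //.
apply: (relM _ _ _ _) => //; rewrite mevalX /peval mmapX /mmap1.
elim/big_ind2: _ => [|a c' b d|i _]; [exact: rel1|exact: relM|].
elim: (mon i) => [|k IHk]; first by rewrite !expr0.
by rewrite !exprS; apply: relM (xpt i) IHk.
Qed.

Lemma in_max_alg c : local_residue A -> in_max (c%:A : A) -> c = 0.
Proof.
move=> loc; rewrite /in_max => /negP nu; apply/eqP/negP => /negP c0; apply: nu.
by apply/unitrPr; exists c^-1%:A; rewrite mulr_algl scalerA divff // scale1r.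
Qed.

Lemma peval_unit (pt : 'I_n -> K) p : local_residue A ->
  (forall a, in_max (x a - (pt a)%:A)) -> p.@[pt] != 0 -> peval x p \is a GRing.unit.
Proof.
move=> loc xpt p0; apply/negPn/negP => /in_maxN mp.
have := in_maxD loc (peval_congr p loc xpt) mp; rewrite addrAC subrr add0r.
move=> /in_maxN; rewrite opprK => /(in_max_alg loc) E.
by rewrite E eqxx in p0.
Qed.

Lemma peval_in_max (pt : 'I_n -> K) p : local_residue A ->
  (forall a, in_max (x a - (pt a)%:A)) -> p.@[pt] = 0 -> in_max (peval x p).
Proof.
move=> loc xpt p0; have := peval_congr p loc xpt.
by rewrite p0 scale0r subr0.
Qed.
End Evaluation.

Lemma peval_morph (K : fieldType) n (A B : comUnitAlgType K)
    (h : {lrmorphism A -> B}) (x : 'I_n -> A) p :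
  peval (h \o x) p = h (peval x p).
Proof.
rewrite /peval /mmap rmorph_sum; apply: eq_bigr => mon _; rewrite rmorphM /=.
rewrite linearZ /= rmorph1 /mmap1 rmorph_prod; congr (_ * _).
by apply: eq_bigr => i _; rewrite rmorphXn.
Qed.

Section LocalRing.
Variables (K : fieldType) (n : nat) (eqs : {mpoly K[n]} -> Prop) (pt : 'I_n -> K).
Variables (R : comUnitAlgType K) (x : 'I_n -> R).
Hypothesis xR : is_local_ring_at eqs pt x.

Lemma local_ring_eqs p : eqs p -> peval x p = 0.
Proof.
case: xR => _ _ x0 ep; apply/x0; exists 1; rewrite meval1 oner_neq0; split=> //.
by rewrite mul1r; apply: ideal_gen_mem.
Qed.

(** Were p'/q an inverse of p, some s with s(pt) nonzero would put s (q - p p') in the ideal of the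
    equations; evaluating at [pt], which solves them, gives s(pt) q(pt) = 0. *)
Lemma local_ring_in_max p : (forall q, eqs q -> q.@[pt] = 0) ->
  p.@[pt] = 0 -> in_max (peval x p).
Proof.
case: xR => _ xfrac x0 eqs0 p0; apply/negP => /unitrPr[r rp].
have [p' [q [q0 rq]]] := xfrac r.
have : peval x (q - p * p') = 0.
  by rewrite rmorphB rmorphM /= -rq mulrA rp mul1r subrr.
case/x0 => s [s0 sI].
have : (s * (q - p * p')).@[pt] = 0.
  apply: (ideal_gen_min (I := fun p => p.@[pt] = 0)) sI => //.
  split=> [|a b ea eb|a b eb]; first exact: meval0.
    by rewrite mevalD ea eb addr0.
  by rewrite mevalM eb mulr0.
rewrite mevalM mevalB mevalM p0 mul0r subr0 => /eqP.
by rewrite mulf_eq0 (negPf s0) (negPf q0).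
Qed.

Variables (A : comUnitAlgType K) (y : 'I_n -> A).
Hypotheses (loc : local_residue A) (y_pt : forall a, in_max (y a - (pt a)%:A)).
Hypothesis y_eqs : forall p, eqs p -> peval y p = 0.

(** A fraction p/q is sent to p(y)/q(y). Numerators and denominators are picked by choice; [hE], by
    which every fraction representing r computes [h r], then yields linearity and
    multiplicativity. *)
Lemma local_ring_universal : exists h : {lrmorphism R -> A},
  local_morphism h /\ forall a, h (x a) = y a.
Proof.
case: xR => xunit xfrac x0.
have yunit q : q.@[pt] != 0 -> peval y q \is a GRing.unit by apply: peval_unit.
pose pq r := constructive_indefinite_description _ (xfrac r).
pose num r := sval (pq r).
pose den r := sval (constructive_indefinite_description _ (svalP (pq r))).
have denP r : (den r).@[pt] != 0 /\ r * peval x (den r) = peval x (num r).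
  exact: svalP (constructive_indefinite_description _ (svalP (pq r))).
pose h r := peval y (num r) / peval y (den r).
have hP r p q : q.@[pt] != 0 -> r * peval x q = peval x p -> h r * peval y q = peval y p.
  move=> q0 rq; have [d0 rd] := denP r.
  have : peval x (p * den r - num r * q) = 0.
    by rewrite rmorphB !rmorphM /= -rq -rd; ring.
  case/x0 => s [s0 /(peval_ideal y_eqs)]; rewrite rmorphM rmorphB !rmorphM /=.
  (* [s] does not vanish at [pt], so its value at [y] is a unit and cancels. *)
  move/(canRL (mulKr (yunit _ s0))); rewrite mulr0 => /subr0_eq E.
  by rewrite /h mulrAC -E mulrK // yunit.
have hE r p q : q.@[pt] != 0 -> r * peval x q = peval x p -> h r = peval y p / peval y q.
  by move=> q0 /(hP _ _ _ q0) <-; rewrite mulrK // yunit.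
have hlin : linear h.
  move=> c r s; have [dr rr] := denP r; have [ds ss] := denP s.
  rewrite (hE _ (c *: (num r * den s) + num s * den r) (den r * den s)).
  - rewrite rmorphD /= pevalZ !rmorphM /= /h invrM ?yunit // mulrDl -scalerAl.
    congr (_ *: _ + _); first by rewrite mulrA mulrK ?yunit.
    by rewrite mulrA mulrAC mulrK ?yunit.
  - by rewrite mevalM mulf_neq0.
  - rewrite rmorphD /= pevalZ !rmorphM /= -rr -ss mulrDl -!scalerAl; congr (_ *: _ + _); ring.
have hmul : monoid_morphism h.
  split; first by rewrite (hE _ 1 1) ?meval1 ?oner_neq0 ?rmorph1 ?mulr1 ?divr1.
  move=> r s; have [dr rr] := denP r; have [ds ss] := denP s.
  rewrite (hE _ (num r * num s) (den r * den s)).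
  - by rewrite !rmorphM /= /h invrM ?yunit //; ring.
  - by rewrite mevalM mulf_neq0.
  - by rewrite !rmorphM /= -rr -ss; ring.
pose H : {lrmorphism R -> A} := HB.pack h (GRing.isLinear.Build K R A *:%R h hlin)
  (GRing.isMonoidMorphism.Build R A h hmul).
exists H; split=> [r mr|a].
  have [dr rr] := denP r; rewrite -[H r]/(h r) /h mulrC; apply: in_maxM.
  apply: (peval_in_max loc y_pt).
  apply/eqP/negP => /negP /xunit; rewrite -rr unitrM => /andP[ur _].
  by move: mr; rewrite /in_max ur.
rewrite -[H _]/(h _) (hE _ 'X_a 1) ?pevalX ?rmorph1 ?meval1 ?oner_neq0 ?mulr1 ?divr1 //.
Qed.
End LocalRing.

(** * Cochains with coefficients in the maximal ideal *)

Section Tensor.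
Variables (K : fieldType) (A : comUnitAlgType K) (m : nat).
Hypothesis loc : local_residue A.

Lemma small_sum k (I : Type) (r : seq I) (P : pred I) (a : I -> A)
    (f : I -> cochain A m k) :
  (forall i, P i -> in_max (a i)) -> small (\sum_(i <- r | P i) a i *: f i).
Proof.
move=> ma S j; rewrite sum_ffunE summxE; apply: in_max_sum => // i Pi.
by rewrite !ffunE mxE mulrC; apply/in_maxM/ma.
Qed.

Lemma tensor_small k (U : {vspace cochain K m k}) xi :
  in_max_tensor U xi -> small (xi : cochain A m k).
Proof. by move=> [a [ma ->]]; apply: small_sum. Qed.

(** [in_max_tensor] fixes the basis [vbasis U]; expanding the [u i] on it frees later arguments from
    that choice. *)
Lemma tensor_sum k (U : {vspace cochain K m k}) (I : Type) (r : seq I) (P : pred I)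
    (a : I -> A) (u : I -> cochain K m k) :
  (forall i, P i -> in_max (a i)) -> (forall i, P i -> u i \in U) ->
  in_max_tensor U (\sum_(i <- r | P i) a i *: cext A (u i)).
Proof.
move=> ma Uu.
exists (fun j => \sum_(i <- r | P i) a i * (coord (vbasis U) j (u i))%:A); split=> [j|].
  by apply: in_max_sum => // i Pi; rewrite mulrC; apply/in_maxM/ma.
under [RHS]eq_bigr => j _ do rewrite scaler_suml.
rewrite exchange_big; apply: eq_bigr => i Pi /=.
rewrite {1}(coord_vbasis (Uu i Pi)) cext_sum scaler_sumr; apply: eq_bigr => j _.
by rewrite cextZ scalerA (tnth_nth 0).
Qed.

Lemma tensor_lext k l (U : {vspace cochain K m l}) (p : 'Hom(cochain K m k, cochain K m l))
    (xi : cochain A m k) :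
  (forall v, p v \in U) -> small xi -> in_max_tensor U (lext p xi).
Proof.
move=> pU mxi; rewrite /lext pair_big /=.
by apply: (@tensor_sum l U _ _ _ (fun q : ksubset m k * 'I_m => xi q.1 q.2 0)
  (fun q => p (cdelta K q.1 q.2))).
Qed.

Lemma small_lext k l (p : 'Hom(cochain K m k, cochain K m l)) (xi : cochain A m k) :
  small xi -> small (lext p xi).
Proof. by move=> /(@tensor_lext k l fullv p) h; apply/tensor_small/h => v; apply: memvf. Qed.

Lemma tensor_full k (xi : cochain A m k) : in_max_tensor fullv xi <-> small xi.
Proof.
split=> [/tensor_small //|mxi]; rewrite -[xi]lext_id.
by apply: tensor_lext => // v; apply: memvf.
Qed.

Lemma eq_lext_tensor k l (U : {vspace cochain K m k})
    (p q : 'Hom(cochain K m k, cochain K m l)) (xi : cochain A m k) :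
  {in U, p =1 q} -> in_max_tensor U xi -> lext p xi = lext q xi.
Proof.
move=> pq [a [_ ->]]; rewrite !linear_sum; apply: eq_bigr => i _.
by rewrite !linearZ /= !lext_cext pq // vbasis_mem // mem_tnth.
Qed.

Lemma lext0 k l (xi : cochain A m k) : lext (0 : 'Hom(_, cochain K m l)) xi = 0.
Proof.
rewrite /lext big1 // => S _; rewrite big1 // => i _.
by rewrite zero_lfunE cext0 scaler0.
Qed.

Hypothesis charK : [pchar K] =i pred0.

Lemma two_unit : (2 : A) \is a GRing.unit.
Proof.
have K2 : (2 : K) != 0 by have := charK 2; rewrite !inE /= => ->.
have -> : (2 : A) = (2 : K)%:A by rewrite scaler_nat.
by apply/unitrPr; exists (2^-1)%:A; rewrite mulr_algl scalerA divff // scale1r.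
Qed.

Lemma two_inj (a : A) : a *+ 2 = 0 -> a = 0.
Proof. by rewrite -mulr_natr => /(canRL (mulrK two_unit)); rewrite mul0r. Qed.

End Tensor.

(** * Polarization of the square and the gauge action *)

Section Bilinear.
Variables (R : comNzRingType) (m : nat).
Local Notation vec := 'cV[R]_m.
Local Notation dl := (@dl R m).

(** The cross term is 2 [f, y], and [f, y] = - dy in degree 2. *)
Lemma nrsquareD (f y : cochain R m 2) :
  nrsquare (f + y) = nrsquare f - dCE f y *+ 2 + nrsquare y.
Proof.
apply/ffunP => S; rewrite !(nrsquare_enum, ffunE).
have DL g s : circ (f + y) g s = circ f g s + circ (y : cochain R m 2) (g : cochain R m 2) s.
  by have := circ_linearl (p := 1) g s 1 f y; rewrite !scale1r.
have DR (g : cochain R m 2) s : circ g (f + y) s = circ g f s + circ (p := 1) g y s.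
  by have := circ_linearr (p := 1) g s 1 f y; rewrite !scale1r.
rewrite DL !DR mul1n; apply/colP => i; rewrite !mxE; ring.
Qed.

Lemma ev2_ext_alternating (G : vec -> vec -> vec) (f : cochain R m 2) :
  (forall v, linear (G^~ v)) -> (forall u v, G u v = - G v u) ->
  (forall x, G (dl x) (dl x) = 0) ->
  (forall (S : ksubset m 2) x y, enum (val S) = [:: x; y] -> f S = G (dl x) (dl y)) ->
  forall u v, ev2 f u v = G u v.
Proof.
move=> lG GC G0 E; apply: (ev2_ext (G := G)) => // [w|x y].
  by move=> a w1 w2; rewrite !(GC w) lG scalerN opprD.
pose F x y := G (dl x) (dl y).
apply: (alternating_ext (G' := fun s => if s is [:: x; y] then F x y else 0)
  (ceval_alternating _) _ _ (s := [:: x; y])) => //.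
  by apply: alternating2 => *; [exact: G0|exact: GC].
by move=> S; rewrite ceval_enum; have [a [b ES]] := enum2 S; rewrite (E S a b ES) ES.
Qed.

Definition mx_of (L : cochain R m 1) : 'M[R]_m := \matrix_(i, j) ev1 L (dl j) i 0.

Lemma mulmx_linear (M : 'M[R]_m) : linear (fun u : vec => M *m u).
Proof. by move=> a u v; rewrite mulmxDr scalemxAr. Qed.

Lemma mulmx_dl (M : 'M[R]_m) j : M *m dl j = col j M.
Proof. by rewrite colE. Qed.

Lemma mx_ofE L u : mx_of L *m u = ev1 L u.
Proof.
move: u; apply: linear_ext => [||j]; [exact: mulmx_linear|exact: ev1_linear|].
by rewrite mulmx_dl; apply/colP => i; rewrite !mxE.
Qed.
End Bilinear.

Section Gauge.
Variables (A : comUnitRingType) (m : nat).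
Local Notation dl := (@dl A m).

Lemma gauge_actE (s : 'M[A]_m) (phi : cochain A m 2) (S : ksubset m 2) x y :
  enum (val S) = [:: x; y] ->
  gauge_act s phi S = s *m ev2 phi (invmx s *m dl x) (invmx s *m dl y).
Proof. by move=> ES; rewrite ffunE ES mev_mceval /= !mulmx_dl. Qed.

Hypothesis two : forall a : A, a *+ 2 = 0 -> a = 0.

Lemma ev2xx (f : cochain A m 2) u : ev2 f u u = 0.
Proof.
apply/colP => i; rewrite [RHS]mxE; apply: two.
by rewrite mulr2n {1}ev2C mxE addNr.
Qed.

Lemma ev2_gauge_act (s : 'M[A]_m) (phi : cochain A m 2) u v :
  ev2 (gauge_act s phi) u v = s *m ev2 phi (invmx s *m u) (invmx s *m v).
Proof.
move: u v; apply: ev2_ext_alternating => [v|u v|x|S x y].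
- by move=> a u u'; rewrite mulmx_linear ev2Pl mulmx_linear.
- by rewrite ev2C mulmxN.
- by rewrite ev2xx mulmx0.
- exact: gauge_actE.
Qed.

Lemma gauge_act_lie (s : 'M[A]_m) (phi : cochain A m 2) :
  s \in unitmx ->
  is_lie_law phi -> is_lie_law (gauge_act s phi).
Proof.
move=> us lie; apply: jacobi_lie => u v w.
rewrite /circ_ev !ev2_gauge_act !mulmxA mulVmx // !mul1mx.
rewrite -mulmxBr -mulmxDr -[RHS](mulmx0 _ s); congr (_ *m _).
exact: (lie_jacobi two lie).
Qed.
End Gauge.

(** * The Kuranishi map and the law of the slice *)

Section Kuranishi.
Variables (K : fieldType) (m : nat) (phi0 : cochain K m 2).
Variables (H2 W2 : {vspace cochain K m 2}) (H3 W3 : {vspace cochain K m 3}).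
Hypotheses (hodge2 : hodge_decomposition phi0 H2 W2).
Hypotheses (hodge3 : hodge_decomposition phi0 H3 W3).
Local Notation d := (dlin phi0 1).
Local Notation B2 := (coboundaries phi0 0).
Local Notation B3 := (coboundaries phi0 1).
Local Notation pB3 := (proj_B3 phi0 H3 W3).

Lemma daddv_pi_kill (vT : vectType K) (U V : {vspace vT}) v :
  (U :&: V = 0)%VS -> v \in V -> daddv_pi U V v = 0.
Proof.
move=> UV Vv; have VU : (V :&: U = 0)%VS by rewrite capvC.
have := daddv_pi_add UV (subvP (addvSr U V) _ Vv).
by rewrite (daddv_pi_id VU Vv) => /(canRL (addrK _)); rewrite subrr.
Qed.

(** Taken along all of Z^2, so that d sees nothing but this component. *)
Definition proj_W2 := daddv_pi W2 (cocycles phi0 1).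

Lemma cap_W2 : (W2 :&: cocycles phi0 1 = 0)%VS.
Proof. by case: hodge2 => _ /directv3_cap[_ _ h] ->; rewrite capvC. Qed.

Lemma proj_W2_mem v : proj_W2 v \in W2. Proof. exact: memv_pi. Qed.
Lemma proj_W2_id v : v \in W2 -> proj_W2 v = v.
Proof. exact: daddv_pi_id cap_W2. Qed.
Lemma proj_W2_cocycle v : v \in cocycles phi0 1 -> proj_W2 v = 0.
Proof. exact: daddv_pi_kill cap_W2. Qed.
Lemma proj_W2_compl v : v - proj_W2 v \in cocycles phi0 1.
Proof.
have vf : v \in (W2 + cocycles phi0 1)%VS.
  by case: hodge2 => E _ ->; rewrite addvC E memvf.
rewrite -{1}(daddv_pi_add cap_W2 vf) addrAC subrr add0r.
exact: memv_pi.
Qed.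
Lemma d_proj_W2 v : d (proj_W2 v) = d v.
Proof.
by have := proj_W2_compl v; rewrite memv_ker linearB subr_eq0 => /eqP.
Qed.

Lemma cap_B3 : (B3 :&: (H3 + W3) = 0)%VS.
Proof. by case: hodge3 => _ /directv3_cap[]. Qed.
Lemma pB3_mem v : pB3 v \in B3. Proof. exact: memv_pi. Qed.
Lemma pB3_d v : pB3 (d v) = d v.
Proof. by apply: (daddv_pi_id cap_B3); apply: memv_img; apply: memvf. Qed.

Lemma proj_H3_d v : proj_H3 phi0 H3 W3 (d v) = 0.
Proof.
apply: daddv_pi_kill; first by case: hodge3 => _ /directv3_cap[].
by apply: subvP (addvSl _ _) _ _; apply: memv_img; apply: memvf.
Qed.

(* A partial inverse of d : W2 -> B3. *)
Definition homotopy : 'Hom(cochain K m 3, cochain K m 2) :=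
  (proj_W2 \o d^-1 \o pB3)%VF.

(** [d^-1] returns some preimage of [d v]; it differs from v by a cocycle, which [proj_W2] kills. *)
Lemma homotopy_d v : homotopy (d v) = proj_W2 v.
Proof.
rewrite /homotopy !comp_lfunE pB3_d; apply/eqP; rewrite -subr_eq0 -linearB.
apply/eqP/proj_W2_cocycle; rewrite memv_ker linearB /= subr_eq0.
by rewrite limg_lfunVK // memv_img ?memvf.
Qed.

Lemma d_homotopy v : d (homotopy v) = pB3 v.
Proof. by rewrite /homotopy !comp_lfunE d_proj_W2 limg_lfunVK // pB3_mem. Qed.

Lemma proj_W2_homotopy v : proj_W2 (homotopy v) = homotopy v.
Proof. by rewrite proj_W2_id // /homotopy !comp_lfunE proj_W2_mem. Qed.

Lemma homotopy_pB3 v : homotopy (pB3 v) = homotopy v.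
Proof. by rewrite /homotopy !comp_lfunE (daddv_pi_proj _ cap_B3). Qed.

Variable A : comUnitAlgType K.
Hypotheses (charK : [pchar K] =i pred0) (loc : local_residue A) (complete : adic_complete A).
Implicit Types xi z w : cochain A m 2.

Definition correction z w : cochain A m 2 := 2^-1 *: lext homotopy (nrsquare (z + w)).

Lemma order_correction z : small z -> orderc 2 (correction z).
Proof.
move=> mz; apply: (ordercZ (j := 2)) => //; apply: orderc_lext => //.
apply: (orderc_nrsquare (i := 1) (F := fun w => z + w)).
by apply: ordercD => //; [exact: orderc_small|exact: orderc_id].
Qed.

Lemma lext_W2_correction z w : lext proj_W2 (correction z w) = correction z w.
Proof.
rewrite linearZ /= lext_comp; congr (_ *: _); apply: eq_lext => v.
by rewrite comp_lfunE proj_W2_homotopy.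
Qed.

Lemma small_0 k : small (0 : cochain A m k).
Proof. by move=> S i; rewrite ffunE mxE; apply: in_max0. Qed.

Lemma nrsquare0 : nrsquare (0 : cochain A m 2) = 0.
Proof.
apply/ffunP => S; rewrite nrsquare_enum ffunE.
have := @circ_linearl A m 1 2 0 (enum (val S)) (-1) 0 0.
by rewrite scaler0 addr0 scaleN1r addNr => ->; rewrite mul0rn.
Qed.

Lemma kuranishi_choice : exists g, forall z, small z -> small (g z) /\ g z = correction z (g z).
Proof.
apply: (functional_choice (fun z w => small z -> small w /\ w = correction z w)) => z.
(* Choice needs a value for every z. Smallness is a finite decidable condition, and 0 is a dummy
   value where it fails. *)
have [mz|nz] := boolP [forall S, [forall i, z S i 0 \isn't a GRing.unit]].
  have {}mz : small z by move=> S i; move/forallP/(_ S)/forallP/(_ i): mz.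
  have [w mw ew] := contraction_exists loc complete (small_0 (k := 2)) (order_correction mz).
  by exists w => _; split=> //; rewrite {1}ew add0r.
exists 0 => mz; case/negP: nz; apply/forallP => S; apply/forallP => i; exact: mz.
Qed.

Lemma correction_unique z w w' : small z -> small w -> small w' ->
  w = correction z w -> w' = correction z w' -> w = w'.
Proof.
move=> mz mw mw' ew ew'.
by apply: (contraction_unique (c := 0) loc complete (order_correction mz)) => //;
   rewrite add0r.
Qed.

Definition maurer_cartan xi : Prop :=
  dCE (cext A phi0) xi - 2^-1 *: lext pB3 (nrsquare xi) = 0.

(** Apply [homotopy] to d xi = [xi, xi]_B3 / 2: the left side becomes the W^2-part of xi. *)
Lemma maurer_cartan_correction xi : maurer_cartan xi ->
  lext proj_W2 xi = correction (xi - lext proj_W2 xi) (lext proj_W2 xi).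
Proof.
rewrite /maurer_cartan dCE_lext /correction subrK => /eqP; rewrite subr_eq0 => /eqP E.
have <- : lext homotopy (lext d xi) = lext proj_W2 xi.
  by rewrite lext_comp; apply: eq_lext => v; rewrite comp_lfunE homotopy_d.
rewrite E linearZ /= lext_comp; congr (_ *: _); apply: eq_lext => v.
by rewrite comp_lfunE homotopy_pB3.
Qed.

Lemma lext_d_cocycle z : in_max_tensor (cocycles phi0 1) z -> lext d z = 0.
Proof.
move=> Zz; rewrite -[RHS](lext0 3 z); apply: eq_lext_tensor Zz => v.
by rewrite memv_ker zero_lfunE => /eqP.
Qed.

Lemma lext_W2_cocycle z : in_max_tensor (cocycles phi0 1) z -> lext proj_W2 z = 0.
Proof.
move=> Zz; rewrite -[RHS](lext0 2 z); apply: eq_lext_tensor Zz => v Zv.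
by rewrite zero_lfunE proj_W2_cocycle.
Qed.

Lemma tensor_cocycle xi : small xi ->
  in_max_tensor (cocycles phi0 1) (xi - lext proj_W2 xi).
Proof.
move=> mxi; have -> : xi - lext proj_W2 xi = lext (\1 - proj_W2)%VF xi.
  by rewrite lextD lext_id; congr (_ + _); rewrite lextN.
by apply: tensor_lext => // v; rewrite add_lfunE opp_lfunE id_lfunE proj_W2_compl.
Qed.

(** For a solution xi, uniqueness identifies its W^2-part with g of the rest. Conversely, d kills z,
    and d after [homotopy] is the projection to B^3. *)
Lemma kuranishi_exists : exists g, is_kuranishi_map phi0 W2 H3 W3 (g : cochain A m 2 -> _).
Proof.
have [g gP] := kuranishi_choice; exists g; split=> [z Zz||xi mxi].
- have mz := tensor_small loc Zz; have [mg eg] := gP z mz.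
  (* [g z] is fixed by the projection to W^2, as every value of [correction] is. *)
  rewrite eg -lext_W2_correction -eg.
  exact: tensor_lext (proj_W2_mem) mg.
- have [mg eg] := gP 0 (small_0 (k := 2)).
  apply: (correction_unique (small_0 (k := 2)) mg (small_0 (k := 2)) eg).
  by rewrite /correction addr0 nrsquare0 linear0 scaler0.
have {}mxi := tensor_small loc mxi; split.
  move=> mc; exists (xi - lext proj_W2 xi); first exact: tensor_cocycle.
  have Zz := tensor_cocycle mxi; have mz := tensor_small loc Zz; have [mg eg] := gP _ mz.
  have mw := small_lext loc proj_W2 mxi.
  by rewrite (correction_unique mz mg mw eg (maurer_cartan_correction mc)) subrK.
case=> z Zz ->; have mz := tensor_small loc Zz; have [mg eg] := gP _ mz.
rewrite dCE_lext linearD /= (lext_d_cocycle Zz) add0r {1}eg linearZ /= lext_comp.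
by rewrite (@eq_lext _ _ _ _ _ _ pB3) ?subrr // => v; rewrite comp_lfunE d_homotopy.
Qed.

End Kuranishi.

Section SliceGerms.
Variables (K : fieldType) (m : nat) (phi0 : cochain K m 2).
Variables (H2 W2 : {vspace cochain K m 2}) (H3 W3 : {vspace cochain K m 3}).
Hypotheses (hodge2 : hodge_decomposition phi0 H2 W2).
Hypotheses (hodge3 : hodge_decomposition phi0 H3 W3).
Variable A : comUnitAlgType K.
Hypotheses (charK : [pchar K] =i pred0) (loc : local_residue A).
Variable Y : cochain A m 2.
Hypotheses (Y_slice : in_max_tensor (H2 + W2) Y).
Hypothesis Y_lie : nrsquare Y = dCE (cext A phi0) Y *+ 2.

(** [Y, Y] = 2 dY is a coboundary, so projecting it to B^3 loses nothing. *)
Lemma lie_maurer_cartan : maurer_cartan phi0 H3 W3 Y.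
Proof.
rewrite /maurer_cartan Y_lie raddfMn /= -scalerMnr scalerMnl -mulr_natr mulVr ?two_unit // scale1r.
rewrite !dCE_lext lext_comp (@eq_lext _ _ _ _ _ _ (dlin phi0 1)) ?subrr // => v.
by rewrite comp_lfunE (pB3_d hodge3).
Qed.

Lemma slice_decomposition : lext (proj_H2 phi0 H2 W2) Y + lext (proj_W2 phi0 W2) Y = Y.
Proof.
rewrite -lextD -[RHS]lext_id; apply: eq_lext_tensor Y_slice => v.
have cH : (H2 :&: (coboundaries phi0 0 + W2) = 0)%VS.
  by case: hodge2 => _ /directv3_cap[].
rewrite add_lfunE id_lfunE => /memv_addP[h Hh [w Ww ->]].
rewrite !linearD /= (daddv_pi_id cH Hh) (daddv_pi_kill cH) ?(subvP (addvSr _ _)) //.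
rewrite (proj_W2_id hodge2 Ww) (proj_W2_cocycle hodge2) ?add0r ?addr0 //.
by case: hodge2 => _ _ ->; apply: subvP (addvSr _ _) _ _.
Qed.

(** Y = z + g z for a cocycle z. The W^2-part of Y is g z, and Y has no B^2-part, which forces z =
    y. The obstruction vanishes because the coboundary [Y, Y] = 2 dY has no H^3-part. *)
Lemma kuranishi_slice (g : cochain A m 2 -> cochain A m 2) :
  is_kuranishi_map phi0 W2 H3 W3 g ->
  let y := lext (proj_H2 phi0 H2 W2) Y in
  [/\ in_max_tensor H2 y, y + g y = Y & kuranishi_obstruction phi0 H3 W3 g y = 0].
Proof.
move=> [gW _ gMC] y; have mY := tensor_small loc Y_slice.
have Hy : in_max_tensor H2 y by apply: tensor_lext => // v; apply: memv_pi.
have [z Zz YE] := (gMC Y ((tensor_full loc Y).2 mY)).1 lie_maurer_cartan.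
have gz : lext (proj_W2 phi0 W2) Y = g z.
  rewrite YE linearD /= (lext_W2_cocycle hodge2 Zz) add0r -[RHS]lext_id.
  apply: eq_lext_tensor (gW z Zz) => v Wv.
  by rewrite id_lfunE (proj_W2_id hodge2 Wv).
have yz : y = z.
  by apply: (addIr (g z)); rewrite -YE -gz; apply: slice_decomposition.
have yE : y + g y = Y by rewrite yz.
split=> //; rewrite /kuranishi_obstruction yE Y_lie raddfMn /= dCE_lext lext_comp.
rewrite (@eq_lext _ _ _ _ _ _ 0) ?lext0 ?mul0rn // => v.
by rewrite comp_lfunE (proj_H3_d hodge3) zero_lfunE.
Qed.
End SliceGerms.

(** * Coordinates of laws and the Lie equations *)

Section Coordinates.
Variables (K : fieldType) (m : nat) (phi0 : cochain K m 2).
Variables (n : nat) (e : n.-tuple (cochain K m 2)).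
Hypothesis e_basis : basis_of fullv e.
Local Notation pt := (base_point phi0 e).

Lemma cmap_generic_law (S : comNzRingType) (h : {rmorphism {mpoly K[n]} -> S}) T i :
  cmap h (generic_law e) T i 0 = \sum_a h 'X_a * h (tnth e a T i 0)%:MP.
Proof.
rewrite ffunE mxE /generic_law /law_of sum_ffunE summxE rmorph_sum.
apply: eq_bigr => a _; rewrite !ffunE !mxE rmorphM /=.
by rewrite alg_mpolyC.
Qed.

Lemma base_pointE : phi0 = \sum_a pt a *: tnth e a.
Proof.
rewrite {1}(coord_basis e_basis (memvf phi0)).
by apply: eq_bigr => a _; rewrite (tnth_nth 0).
Qed.

Lemma lie_eqs_base p : is_lie_law phi0 -> lie_eqs e p -> p.@[pt] = 0.
Proof.
move=> lie [S [i ->]].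
have E : cmap (meval pt) (generic_law e) = phi0.
  apply/ffunP => T; apply/colP => j; rewrite cmap_generic_law.
  rewrite [in RHS]base_pointE sum_ffunE summxE; apply: eq_bigr => a _.
  by rewrite /= mevalXU mevalC !ffunE mxE.
have := nrbracket_cmap (meval pt) (generic_law e) (generic_law e) (p := 1) (q := 1).
rewrite E -/(nrsquare _) lie => /ffunP/(_ S)/colP/(_ i).
by rewrite !ffunE !mxE.
Qed.

(** [law_of e y] is the base change of [generic_law] along evaluation at y, and the bracket commutes
    with base change. *)
Lemma law_of_lie (A : comUnitAlgType K) (y : 'I_n -> A) :
  (forall p, lie_eqs e p -> peval y p = 0) <-> is_lie_law (law_of e y).
Proof.
have E : cmap (peval y) (generic_law e) = law_of e y.
  apply/ffunP => T; apply/colP => j; rewrite cmap_generic_law.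
  rewrite sum_ffunE summxE; apply: eq_bigr => a _.
  by rewrite /= pevalX pevalC !ffunE !mxE.
have N := nrbracket_cmap (peval y) (generic_law e) (generic_law e) (p := 1) (q := 1).
rewrite E -/(nrsquare _) in N; split=> [y0|lie p [S [i ->]]].
  rewrite /is_lie_law N; apply/ffunP => S; apply/colP => i.
  have -> : (0 : cochain A m 3) S i 0 = 0 by rewrite ffunE mxE.
  by rewrite ffunE mxE; apply: y0; exists S, i.
move: N; rewrite lie => /ffunP/(_ S)/colP/(_ i).
have -> : (0 : cochain A m 3) S i 0 = 0 by rewrite ffunE mxE.
by rewrite [in X in _ = X -> _]ffunE [in X in _ = X -> _]mxE => <-.
Qed.

Lemma law_of_sub (A : comUnitAlgType K) (y : 'I_n -> A) :
  law_of e y - cext A phi0 = \sum_a (y a - (pt a)%:A) *: cext A (tnth e a).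
Proof.
rewrite [in cext A phi0]base_pointE cext_sum /law_of -sumrB; apply: eq_bigr => a _.
by rewrite cextZ scalerBl.
Qed.

Lemma slice_tensor (A : comUnitAlgType K) (y : 'I_n -> A) (Adm : {set 'I_n}) :
  local_residue A -> (forall a, in_max (y a - (pt a)%:A)) ->
  (forall a, a \in Adm -> y a = (pt a)%:A) ->
  in_max_tensor (slice_space e Adm) (law_of e y - cext A phi0).
Proof.
move=> loc my y0; rewrite law_of_sub (bigID (mem (~: Adm))) /= [X in _ + X]big1 ?addr0.
  by apply: tensor_sum => // a Aa; apply/memv_span/image_f.
by move=> a; rewrite inE negbK => Aa; rewrite y0 // subrr scale0r.
Qed.

Lemma lie_deviation (A : comUnitAlgType K) (Y : cochain A m 2) :
  is_lie_law phi0 -> is_lie_law (cext A phi0 + Y) ->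
  nrsquare Y = dCE (cext A phi0) Y *+ 2.
Proof.
move=> lie0; rewrite /is_lie_law nrsquareD.
have -> : nrsquare (cext A phi0) = 0.
  have := nrbracket_cmap (in_alg A) phi0 phi0 (p := 1) (q := 1).
  rewrite -/(nrsquare _) -/(nrsquare phi0) lie0 => ->; exact: cext0.
by rewrite sub0r addrC => /eqP; rewrite subr_eq0 => /eqP.
Qed.
End Coordinates.

(** * Moving a law into the slice by a gauge transformation *)

Section DetUnit.
Variables (K : fieldType) (A : comUnitAlgType K) (m : nat).
Hypothesis loc : local_residue A.

Lemma det_congr (s t : 'M[A]_m) :
  (forall i j, in_max (s i j - t i j)) -> in_max (\det s - \det t).
Proof.
move=> st; pose rel (a b : A) := in_max (a - b).
have relD a b c d : rel a c -> rel b d -> rel (a + b) (c + d).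
  by rewrite /rel opprD addrACA; apply: in_maxD.
have relM a b c d : rel a c -> rel b d -> rel (a * b) (c * d).
  move=> ac bd; rewrite /rel.
  have -> : a * b - c * d = a * (b - d) + d * (a - c) by ring.
  by apply: in_maxD => //; apply: in_maxM.
have rel_refl a : rel a a by rewrite /rel subrr; apply: in_max0.
rewrite -/(rel _ _) /determinant.
elim/big_ind2: _ => [|a b c d|p _]; [exact: rel_refl|exact: relD|].
apply: (relM _ _ _ _) => //.
by elim/big_ind2: _ => [|a b c d|i _]; [exact: rel_refl|exact: relM|exact: st].
Qed.

Lemma unitmx_congr1 (t : 'M[A]_m) :
  (forall i j, in_max ((t - 1%:M) i j)) -> t \in unitmx.
Proof.
move=> mt; rewrite unitmxE; apply/negPn/negP => dt.
have : in_max (\det t - \det (1%:M : 'M[A]_m)).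
  by apply: det_congr => i j; have := mt i j; rewrite !mxE.
rewrite det1 => /(in_maxN) h; have := in_maxD loc h dt.
by rewrite opprB subrK /in_max unitr1.
Qed.
End DetUnit.

Section GaugeSlice.
Variables (K : fieldType) (m : nat) (phi0 : cochain K m 2).
Variable V : {vspace cochain K m 2}.
Hypotheses (BV : (coboundaries phi0 0 + V = fullv)%VS)
  (capBV : (coboundaries phi0 0 :&: V = 0)%VS).
Variable A : comUnitAlgType K.
Hypotheses (loc : local_residue A) (complete : adic_complete A).
Variable phi : cochain A m 2.
Local Notation zeta := (phi - cext A phi0).
Hypothesis small_zeta : small zeta.
Local Notation dl := (@dl A m).
Local Notation pB := (daddv_pi (coboundaries phi0 0) V).
Local Notation pV := (daddv_pi V (coboundaries phi0 0)).

(** The sign makes xi = eta - dL the splitting of xi along B^2 + V. *)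
Definition potential : 'Hom(cochain K m 2, cochain K m 1) :=
  (- ((dlin phi0 0)^-1 \o pB))%VF.

Lemma d_potential v : dlin phi0 0 (potential v) = - pB v.
Proof.
by rewrite /potential opp_lfunE linearN /= comp_lfunE limg_lfunVK // memv_pi.
Qed.

Lemma ev2_addf (f g : cochain A m 2) u v : ev2 (f + g) u v = ev2 f u v + ev2 g u v.
Proof.
rewrite /ev2 /= -big_split; apply: eq_bigr => i _ /=; rewrite -scalerDr; congr (_ *: _).
rewrite -big_split; apply: eq_bigr => j _ /=; rewrite -scalerDr; congr (_ *: _).
by have := ceval_linear [:: i; j] 1 f g; rewrite !scale1r.
Qed.

Lemma addcE k (f g : cochain A m k) S : (f + g) S = f S + g S.
Proof. by rewrite ffunE. Qed.

Lemma oppcE k (f : cochain A m k) S : (- f) S = - f S.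
Proof. by rewrite ffunE. Qed.

Lemma ev2_enum (f : cochain A m 2) (S : ksubset m 2) x y :
  enum (val S) = [:: x; y] -> f S = ev2 f (dl x) (dl y).
Proof. by move=> ES; rewrite -ceval_enum ES ceval_ev2. Qed.

(* The terms of order at least 2 in phi(tu, tv) = t (phi0 + eta)(u, v), where  *)
(* t = 1 + L.                                                                  *)
Definition gauge_remainder (L : cochain A m 1) (eta : cochain A m 2) : cochain A m 2 :=
  [ffun S : ksubset m 2 => (if enum (val S) is [:: x; y] then
     ev2 zeta (ev1 L (dl x)) (dl y) + ev2 zeta (dl x) (ev1 L (dl y))
     + ev2 phi (ev1 L (dl x)) (ev1 L (dl y)) - ev1 L (ev2 eta (dl x) (dl y))
   else 0) : 'cV[A]_m].

(** Each term has two factors of order 1 among zeta, L and eta; in the third, phi has order 0 but L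
    occurs twice. *)
Lemma order_gauge_remainder :
  orderc 2 (fun xi => gauge_remainder (lext potential xi) (lext pV xi)).
Proof.
pose L xi : cochain A m 1 := lext potential xi.
have hL : orderc 1 L by apply/orderc_lext/orderc_id.
have hL1 w : orderv 1 (fun xi => ev1 (L xi) w).
  by apply: (orderv_ev1 (j := 0)) => //; apply: orderv_cst.
have hV : orderc 1 (fun xi => lext pV xi : cochain A m 2) by apply/orderc_lext/orderc_id.
have hz : orderc 1 (fun=> zeta) by apply: orderc_small.
move=> S i; have [x [y ES]] := enum2 S.
have : orderv 2 (fun xi => ev2 zeta (ev1 (L xi) (dl x)) (dl y)
     + ev2 zeta (dl x) (ev1 (L xi) (dl y))
     + ev2 phi (ev1 (L xi) (dl x)) (ev1 (L xi) (dl y))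
     - ev1 (L xi) (ev2 (lext pV xi) (dl x) (dl y))).
  apply: ordervD; first apply: ordervD; first apply: ordervD.
  - exact: (orderv_ev2 hz (hL1 _) (orderv_cst _)).
  - exact: (orderv_ev2 hz (orderv_cst _) (hL1 _)).
  - exact: (orderv_ev2 (orderc_cst _) (hL1 _) (hL1 _)).
  - apply: ordervN; apply: (orderv_ev1 hL (j := 1)).
    exact: (orderv_ev2 hV (orderv_cst _) (orderv_cst _)).
move/(_ i); apply: eq_order => xi; by rewrite ffunE ES.
Qed.

Lemma gauge_slice : exists s : 'M[A]_m, exists2 eta : cochain A m 2,
  in_max_tensor V eta &
  [/\ forall i j, in_max ((s - 1%:M) i j), s \in unitmx & gauge_act s phi = cext A phi0 + eta].
Proof.
have [xi mxi xiE] := contraction_exists loc complete small_zeta order_gauge_remainder.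
pose L : cochain A m 1 := lext potential xi; pose eta : cochain A m 2 := lext pV xi.
have mL i j : in_max (mx_of L i j).
  rewrite mxE; apply/mpow1 => //.
  have h := orderv_ev1 (orderc_small loc (small_lext loc potential mxi)) (orderv_cst (dl j)).
  (* [order] speaks of functions of a 2-cochain; the function here is constant and 0 is a dummy
     argument. *)
  exact: (h i).1 _ (@small_0 _ m A 2).
pose t := 1%:M + mx_of L.
have tE u : t *m u = u + ev1 L u by rewrite mulmxDl mul1mx mx_ofE.
have ut : t \in unitmx.
  by apply: (unitmx_congr1 loc) => i j; rewrite addrAC subrr add0r.
exists (invmx t), eta; first by apply: tensor_lext => // v; apply: memv_pi.
split=> [i j||]; last 2 first.
- by rewrite unitmx_inv.
- apply/ffunP => S; have [x [y ES]] := enum2 S.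
  (* Cancelling t^-1 leaves phi(tx, ty) = t (phi0 + eta)(x, y). *)
  rewrite (gauge_actE _ _ ES) invmxK -[RHS](mulKmx ut); congr (_ *m _).
  have := congr1 (fun f : cochain A m 2 => f S) xiE.
  have xi_eta : xi = eta - dCE (cext A phi0) L.
    rewrite dCE_lext /L lext_comp -lextN -lextD -[LHS]lext_id; apply: eq_lext => v.
    rewrite id_lfunE add_lfunE opp_lfunE comp_lfunE d_potential opprK.
    have vf : v \in (coboundaries phi0 0 + V)%VS by rewrite BV memvf.
    by rewrite addrC (daddv_pi_add capBV vf).
  rewrite -/L -/eta xi_eta addcE oppcE addcE (ev2_enum eta ES) (ev2_enum (dCE _ _) ES).
  rewrite (ev2_enum zeta ES) [gauge_remainder _ _ S]ffunE ES ev2_dCE.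
  rewrite (ev2_enum (_ + eta) ES) !tE !(ev2Dl, ev2Dr) (ev2_addf _ eta) ev1D.
  have phiE u v : ev2 phi u v = ev2 (cext A phi0) u v + ev2 zeta u v.
    by rewrite -ev2_addf addrC subrK.
  rewrite (phiE (dl x) (dl y)) (phiE (ev1 L _) (dl y)) (phiE (dl x) (ev1 L _)).
  (* Gives this phi0-term the shape it has in dL. *)
  rewrite (ev2C (cext A phi0) (dl x) (ev1 L (dl y))).
  move=> /colP H; apply/colP => k; have := H k; rewrite !mxE => /(canRL (subrK _)) ->; ring.
(* t^-1 - 1 = - t^-1 (t - 1), and t - 1 has its entries in m. *)
have -> : invmx t - 1%:M = - (invmx t *m mx_of L).
  by rewrite -[1%:M](mulVmx ut) -[X in X - _]mulmx1 -mulmxBr opprD addrA subrr add0r mulmxN.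
rewrite !mxE; apply: in_maxN; apply: in_max_sum => // k _; exact: in_maxM.
Qed.
End GaugeSlice.

Section SliceCoordinates.
Variables (K : fieldType) (m : nat) (phi0 : cochain K m 2).
Variables (n : nat) (e : n.-tuple (cochain K m 2)) (Adm : {set 'I_n}).
Hypothesis e_basis : basis_of fullv e.
Local Notation pt := (base_point phi0 e).

Lemma slice_coordinates (A : comUnitAlgType K) (eta : cochain A m 2) :
  local_residue A -> in_max_tensor (slice_space e Adm) eta ->
  exists y : 'I_n -> A,
    [/\ forall a, in_max (y a - (pt a)%:A), forall a, a \in Adm -> y a = (pt a)%:A
      & law_of e y = cext A phi0 + eta].
Proof.
move=> loc [b [mb ->]]; pose v i := tnth (vbasis (slice_space e Adm)) i.
exists (fun a => (pt a)%:A + \sum_i b i * (coord e a (v i))%:A); split=> [a|a Aa|].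
- rewrite addrAC subrr add0r; apply: in_max_sum => // i _.
  by rewrite mulrC; apply: in_maxM.
- rewrite big1 ?addr0 // => i _.
  by rewrite (coord_slice e_basis _ Aa) ?scale0r ?mulr0 // vbasis_mem ?mem_tnth.
- apply/eqP; rewrite addrC -subr_eq; apply/eqP; rewrite (law_of_sub phi0 e_basis).
  under eq_bigr => a _ do rewrite addrAC subrr add0r scaler_suml.
  rewrite exchange_big; apply: eq_bigr => i _ /=.
  rewrite [in RHS](coord_basis e_basis (memvf (tnth _ i))) cext_sum scaler_sumr.
  by apply: eq_bigr => a _; rewrite cextZ scalerA (tnth_nth 0 e).
Qed.
End SliceCoordinates.

Theorem corollary2p3
    (K : closedFieldType) (charK : [pchar K] =i pred0)
    (m : nat) (phi0 : cochain K m 2) (lie0 : is_lie_law phi0)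
    (n : nat) (e : n.-tuple (cochain K m 2)) (e_basis : basis_of fullv e)
    (Adm : {set 'I_n}) (adm : admissible phi0 e Adm)
    (O : comUnitAlgType K) (x : 'I_n -> O)
    (O_local : is_local_ring_at (lie_eqs e) (base_point phi0 e) x)
    (OA : comUnitAlgType K) (xA : 'I_n -> OA)
    (OA_local : is_local_ring_at (slice_eqs phi0 e Adm) (base_point phi0 e) xA)
    (pi : {lrmorphism O -> OA}) (pi_germs : forall a, pi (x a) = xA a) :
  (forall A : comUnitAlgType K,
     local_residue A -> noetherian A -> adic_complete A ->
   forall h : {lrmorphism O -> A}, local_morphism h ->
   exists h0bar : {lrmorphism OA -> A},
     local_morphism h0bar /\ deformation_equiv e x h (h0bar \o pi))
  /\
  (forall (OAhat : comUnitAlgType K) (c : {lrmorphism OA -> OAhat}),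
     is_completion c ->
   let Y := law_of e (c \o xA) - cext OAhat phi0 in
   (exists H2 W2 H3 W3, hodge_compatible phi0 H2 W2 H3 W3 e Adm) /\
   forall H2 W2 H3 W3, hodge_compatible phi0 H2 W2 H3 W3 e Adm ->
     let y := lext (proj_H2 phi0 H2 W2) Y in
     exists g : cochain OAhat m 2 -> cochain OAhat m 2,
       [/\ is_kuranishi_map phi0 W2 H3 W3 g,
           in_max_tensor H2 y,
           cext OAhat phi0 + Y = cext OAhat phi0 + y + g y
         & kuranishi_obstruction phi0 H3 W3 g y = 0]).
Proof.
have two (a : K) : a *+ 2 = 0 -> a = 0.
  move/eqP; rewrite -mulr_natr mulf_eq0 => /orP[/eqP //|].
  by have := charK 2; rewrite !inE /= => ->.
have d0 k (f : cochain K m k.+1) : (k < 2)%N -> dlin phi0 k.+1 (dlin phi0 k f) = 0.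
  case: k f => [|[|//]] f _; rewrite lfunE /= [dlin _ _ f]lfunE /=.
    exact: dCE_dCE0.
  exact: dCE_dCE1.
have eqs0 : forall q, lie_eqs e q -> q.@[base_point phi0 e] = 0.
  by move=> q; apply: lie_eqs_base.
have eqsA0 : forall q, slice_eqs phi0 e Adm q -> q.@[base_point phi0 e] = 0.
  move=> q [/eqs0 //|[a _ ->]]; by rewrite mevalB mevalXU mevalC subrr.
have coordE (R : comUnitAlgType K) (y : 'I_n -> R) a :
    y a - (base_point phi0 e a)%:A = peval y ('X_a - (base_point phi0 e a)%:MP).
  by rewrite rmorphB /= pevalX pevalC.
have BV := admissible_sum e_basis adm; have capBV := admissible_cap e_basis adm.
split=> [A loc _ complete h hloc|Oh c [loc complete c_pow _] Y].
  (* A coordinate minus its value vanishes at the base point, so its germ lies in the maximal ideal,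
     which [h] respects. *)
  have mx a : in_max (h (x a) - (base_point phi0 e a)%:A).
    have -> : h (x a) - (base_point phi0 e a)%:A = h (x a - (base_point phi0 e a)%:A).
      by rewrite rmorphB /= rmorph_alg.
    apply: hloc; rewrite coordE; apply: (local_ring_in_max O_local eqs0).
    by rewrite mevalB mevalXU mevalC subrr.
  have small_zeta : small (law_of e (h \o x) - cext A phi0).
    by rewrite (law_of_sub phi0 e_basis); apply: small_sum => // a _; apply: mx.
  have lie : is_lie_law (law_of e (h \o x)).
    apply/law_of_lie => p ep.
    by rewrite peval_morph (local_ring_eqs O_local ep) rmorph0.
  have [s [eta Veta [ms us sE]]] := gauge_slice BV capBV loc complete small_zeta.
  have [y [my yAdm yE]] := slice_coordinates phi0 e_basis loc Veta.
  (* The linear equations hold by the choice of y, the Lie equations because the law of y is a gauge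
     transform of a Lie law. *)
  have y_eqs p : slice_eqs phi0 e Adm p -> peval y p = 0.
    case=> [|[a Aa ->]]; last by rewrite -coordE yAdm // subrr.
    move: p; apply/law_of_lie; rewrite yE -sE; apply: gauge_act_lie => //.
    exact: two_inj.
  have [h0 [h0loc h0E]] := local_ring_universal OA_local loc my y_eqs.
  exists h0; split=> //; exists s; split=> //; rewrite sE -yE.
  by apply: eq_bigr => a _; rewrite /= pi_germs h0E.
have cxA a : c (xA a) - (base_point phi0 e a)%:A = c (xA a - (base_point phi0 e a)%:A).
  by rewrite rmorphB /= rmorph_alg.
have mx a : in_max ((c \o xA) a - (base_point phi0 e a)%:A).
  (* The completion clause at k = 1 carries membership in m across [c]; in the first power it is
     witnessed by a product with one factor. *)
  rewrite /= cxA -mpow1 // c_pow; apply: ideal_gen_mem.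
  exists (fun=> xA a - (base_point phi0 e a)%:A); split=> [_|]; last by rewrite big_ord1.
  rewrite coordE; apply: (local_ring_in_max OA_local eqsA0).
  by rewrite mevalB mevalXU mevalC subrr.
have xAdm a : a \in Adm -> (c \o xA) a = (base_point phi0 e a)%:A.
  move=> Aa; apply/eqP; rewrite -subr_eq0 /= cxA coordE (local_ring_eqs OA_local).
    by rewrite rmorph0.
  by right; exists a.
have VY : in_max_tensor (slice_space e Adm) Y by apply: slice_tensor.
have lieY : nrsquare Y = dCE (cext Oh phi0) Y *+ 2.
  apply: lie_deviation => //; rewrite addrC subrK; apply/law_of_lie => p ep.
  by rewrite peval_morph (local_ring_eqs OA_local) ?rmorph0 //; left.
split=> [|H2 W2 H3 W3 [hodge2 hodge3 VE] y].
  (* In degree 2 the complement of the coboundaries is dictated by the slice; in degree 3 any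
     complement serves. *)
  have [H2 [W2 [hodge2 VE]]] := hodge_exists d0 (isT : 0 < 2)%N BV capBV.
  have [H3 [W3 [hodge3 _]]] := hodge_exists d0 (isT : 1 < 2)%N
    (addv_complf (coboundaries phi0 1)) (capv_compl _).
  by exists H2, W2, H3, W3.
rewrite VE in VY.
have [g gP] := kuranishi_exists hodge2 hodge3 loc complete.
have [Hy yE Om] := kuranishi_slice hodge2 hodge3 charK loc VY lieY gP.
by exists g; split=> //; rewrite -addrA yE.
Qed.
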